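(* There exist absolute positive constants $C$ and $c$, and for every $u,v\in(0,1)$ and $\beta\in(0,1)$ there exist positive constants $M=M(u,v,\beta)$ and $C(u,v,\beta)$ depending only on $u,v,\beta$, such that the following holds. Let $n,N$ be positive integers with $Mn<N\le e^n$, and let $\Gamma=\{\xi_{ij}\}$ be an $N\times n$ random matrix whose entries are independent symmetric real random variables with unit variances, identically distributed within each row, and satisfying $\sup_{\lambda\in\mathbb{R}}\mathbb{P}\{|\xi_{ij}-\lambda|\le u\}\le v$ for all $i,j$. Let $K_N=\Gamma^*B_1^N$. Then with probability at least $1-\exp\left(-c\,n^\beta N^{1-\beta}\right)$ one has $$|K_N|^{1/n}\ge2C(u,v,\beta)\sqrt{\frac{\ln(N/n)}{n}}\quad\text{and}\quad|K_N^0|^{1/n}\le\frac{C}{C(u,v,\beta)\sqrt{n\ln(N/n)}}.$$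
   Context: $B_1^N$ is the unit ball of $\ell_1^N$ and $\Gamma^*$ is the transpose of $\Gamma$, so $K_N$ is the absolute convex hull of the rows of $\Gamma$. $|K|$ denotes the $n$-dimensional volume of $K\subset\mathbb{R}^n$. The polar is $K^0=\{x\in\mathbb{R}^n:\langle x,y\rangle\le1\ \text{for every }y\in K\}$. *)

(* Defs.v *)
From HB Require Import structures.
From mathcomp Require Import all_boot all_order all_algebra.
From mathcomp Require Import all_classical all_reals all_analysis.

Set Implicit Arguments.
Unset Strict Implicit.
Unset Printing Implicit Defensive.

Import Order.TTheory GRing.Theory Num.Theory.
Import numFieldNormedType.Exports.

Local Open Scope classical_set_scope.
Local Open Scope ring_scope.

Section tuple_measure_succ.
Context d (T : measurableType d) (R : realType) (n : nat).
Variables (m : {sigma_finite_measure set T -> \bar R})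
          (mu : {sigma_finite_measure set (n.-tuple T) -> \bar R}).

Definition cons_pair (p : T * n.-tuple T) : n.+1.-tuple T :=
  [the n.+1.-tuple T of p.1 :: p.2].

Lemma measurable_cons_pair : measurable_fun [set: T * n.-tuple T] cons_pair.
Proof. by apply: measurable_cons; [exact: measurable_fst|exact: measurable_snd]. Qed.

Definition tuple_measure_succ : set (n.+1.-tuple T) -> \bar R :=
  pushforward (m \x mu)%E cons_pair.

Let tuple_measure_succ0 : tuple_measure_succ set0 = 0%E.
Proof. by rewrite /tuple_measure_succ /pushforward preimage_set0 measure0. Qed.

Let tuple_measure_succ_ge0 A : (0 <= tuple_measure_succ A)%E.
Proof. by rewrite /tuple_measure_succ /pushforward measure_ge0. Qed.

Let tuple_measure_succ_sigma_additive : semi_sigma_additive tuple_measure_succ.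
Proof.
exact: (@measure_semi_sigma_additive _ _ _
  (measure_function_pushforward__canonical__measure_function_Measure
     _ measurable_cons_pair)).
Qed.

HB.instance Definition _ := isMeasure.Build _ _ _ tuple_measure_succ
  tuple_measure_succ0 tuple_measure_succ_ge0 tuple_measure_succ_sigma_additive.

Let tuple_measure_succ_sigma_finite : sigma_finite setT tuple_measure_succ.
Proof.
have /sigma_finiteP[F1 [TF1 ndF1 F1oo]] := sigma_finiteT m.
have /sigma_finiteP[F2 [TF2 ndF2 F2oo]] := sigma_finiteT mu.
pose g (t : n.+1.-tuple T) : T * n.-tuple T := (thead t, [tuple of behead t]).
have mg : measurable_fun [set: n.+1.-tuple T] g.
  by apply/measurable_fun_pair; [exact: measurable_tnth|exact: measurable_behead].
have gK p : g (cons_pair p) = p.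
  by case: p => x t; rewrite /g /cons_pair; congr pair; exact/val_inj.
exists (fun k => g @^-1` (F1 k `*` F2 k)).
  rewrite -preimage_bigcup -[LHS](preimage_setT g); congr preimage.
  apply/esym; rewrite -subTset => -[x t] _.
  have [k _ F1x] : (\bigcup_k F1 k) x by rewrite -TF1.
  have [l _ F2t] : (\bigcup_k F2 k) t by rewrite -TF2.
  exists (maxn k l) => //; split => /=.
  - by move: x F1x; exact/subsetPset/ndF1/leq_maxl.
  - by move: t F2t; exact/subsetPset/ndF2/leq_maxr.
move=> k; have [mF1 F1k] := F1oo k; have [mF2 F2k] := F2oo k; split.
  by rewrite -[X in measurable X]setTI; apply: mg => //; exact: measurableX.
rewrite /tuple_measure_succ /pushforward -comp_preimage.
rewrite (_ : g \o _ = id); last exact/funext.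
by rewrite product_measure1E// lte_mul_pinfty// ge0_fin_numE.
Qed.

HB.instance Definition _ := Measure_isSigmaFinite.Build _ _ _
  tuple_measure_succ tuple_measure_succ_sigma_finite.

End tuple_measure_succ.

Fixpoint tuple_measure d (T : measurableType d) (R : realType)
    (m : {sigma_finite_measure set T -> \bar R}) (n : nat) :
    {sigma_finite_measure set (n.-tuple T) -> \bar R} :=
  match n with
  | 0 => @dirac _ (0.-tuple T) [tuple] R
  | k.+1 => tuple_measure_succ m (tuple_measure m k)
  end.

Lemma tuple_measure_box d (T : measurableType d) (R : realType)
    (m : {sigma_finite_measure set T -> \bar R}) (n : nat) (A : 'I_n -> set T) :
  (forall i, measurable (A i)) ->
  tuple_measure m n [set t | forall i, A i (tnth t i)] = (\prod_(i < n) m (A i))%E.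
Proof.
elim: n A => [A _|n IHn A mA] /=.
  rewrite big_ord0 diracE mem_set//; first by case.
rewrite /tuple_measure_succ /pushforward big_ord_recl -IHn//.
rewrite -product_measure1E//; last first.
  rewrite (_ : mkset _ = \bigcap_(i in [set: 'I_n])
    ((@tnth n T)^~ i @^-1` A (lift ord0 i))); last first.
    by apply/seteqP; split => [t ? i _|t At i]; [|exact: At].
  apply: fin_bigcap_measurable; first exact: finite_finset.
  move=> i _; rewrite -[X in measurable X]setTI.
  exact: measurable_tnth.
congr (_ _); apply/seteqP; split=> -[x t] /=.
  move=> At; split; first exact: (At ord0).
  by move=> i; have := At (lift ord0 i); rewrite tnthS.
move=> [Ax At] i; case: (unliftP ord0 i) => [j|] ->//.
by rewrite tnthS; exact: At.
Qed.

(* For n = 0 this is the Dirac mass at the only point. On Borel sets it is the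
   Lebesgue measure: it is a product measure by construction, and
   [tuple_measure_box] gives its value on boxes. *)
Definition volume (R : realType) (n : nat) (A : set 'cV[R]_n) : \bar R :=
  tuple_measure (@lebesgue_measure R) n [set t | A (\col_i tnth t i)].

Definition polar (R : realType) (n : nat) (K : set 'cV[R]_n) : set 'cV[R]_n :=
  [set x | forall y, K y -> \sum_(i < n) x i 0 * y i 0 <= 1].

Definition ball1 (R : realType) (N : nat) : set 'cV[R]_N :=
  [set x | \sum_(i < N) `|x i 0| <= 1].

(* K_N = Gamma^* B_1^N, the absolute convex hull of the rows of G *)
Definition abs_conv_rows (R : realType) (N n : nat) (G : 'M[R]_(N, n)) :
    set 'cV[R]_n :=
  [set G^T *m x | x in @ball1 R N].

Section random_variables.
Context d (T : measurableType d) (R : realType) (P : probability T R).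

(* [distribution P X] is only meaningful on measurable sets, hence the
   restriction to these rather than an equality of functions. *)
Definition identically_distributed (X Y : T -> R) :=
  forall A : set R, measurable A -> P (X @^-1` A) = P (Y @^-1` A).

Definition symmetric_RV (X : T -> R) :=
  identically_distributed X (fun w => - X w).

Definition mutually_independent (I : finType) (X : I -> {RV P >-> R}) :=
  forall (J : {set I}) (A : I -> set R), (forall i, measurable (A i)) ->
  P (\bigcap_(i in [set` J]) (X i @^-1` A i)) =
    (\prod_(i in J) P (X i @^-1` A i))%E.

Definition concentration (X : T -> R) (u : R) : \bar R :=
  ereal_sup [set P [set w | `|X w - l| <= u] | l in [set: R]].

Definition random_matrix (N n : nat) (xi : 'I_N -> 'I_n -> {RV P >-> R}) (w : T)
    : 'M[R]_(N, n) :=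
  \matrix_(i < N, j < n) xi i j w.

End random_variables.

(* Main.v *)
Require Import Defs.
From HB Require Import structures.
From mathcomp Require Import all_boot all_order all_algebra.
From mathcomp Require Import ring lra.
From mathcomp Require Import all_classical all_reals all_analysis.
From mathcomp Require Import measurable_realfun.

Set Implicit Arguments.
Unset Strict Implicit.
Unset Printing Implicit Defensive.

Import Order.TTheory GRing.Theory Num.Theory.
Import numFieldNormedType.Exports.

Local Open Scope classical_set_scope.
Local Open Scope ring_scope.

(** It suffices that K_N contains a cube r^-1 [-1,1]^n with r of order
    sqrt(n / L), L = ln (N / n): its volume gives the first bound, and then the
    polar lies in the l1-ball of radius r, whose volume radius is of order r / n.

    Dually, no x with large l1-norm may satisfy |<row_i, x>| <= 1 for all i. Fix x
    with |x|_1 >= a, a of order sqrt(n / L). By symmetry the signs of the entries of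
    a row are independent of their absolute values; cutting {1..n} into m of order
    L blocks and applying Paley-Zygmund in each of them, |<row_i, x>| > 2 and
    |row_i|^2 <= C n hold together with probability at least p = c 10^-m, which is
    at least (n / N)^(beta / 2). By Chernoff, fewer than p N / 4 rows do this with
    probability at most e^(- p N / 4).

    Nets are replaced by volumes. Let S be the random set of those x with
    a <= |x|_1 <= 3 a for which fewer than p N / 4 rows do this. By Fubini the
    expected volume of S is at most |3 a B_1| e^(- p N / 4). If some x in the polar
    had |x|_1 = 2 a, then x + y would be in S for every y in a small cube such that
    \sum <row_i, y>^2, summed over the rows of norm at most sqrt(C n), is less than
    p N / 4. Averaging over signs, this is at least half of the cube, so S has volume
    at least half of that of the cube, an event excluded by Markov's inequality. *)

(** * Rademacher sums *)

Section sign_means.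
Context {R : realType}.
Implicit Types (f g : R -> R) (s : seq R).

(** The expectation of [f] at the Rademacher sum with coefficients [s]. Conditioning on the first
    sign is built into the recursion, so moments are computed by induction on [s] with a shifted
    [f]. *)
Fixpoint sign_mean f s : R :=
  if s is a :: s' then
    (sign_mean (fun z => f (a + z)) s' + sign_mean (fun z => f (- a + z)) s') / 2
  else f 0.

Lemma sign_mean_ext f g s : f =1 g -> sign_mean f s = sign_mean g s.
Proof. by move=> /funext ->. Qed.

Lemma le_sign_mean f g s :
  (forall z, f z <= g z) -> sign_mean f s <= sign_mean g s.
Proof.
elim: s f g => [|a s IH] f g fg //=.
by rewrite ler_pM2r ?invr_gt0// lerD// IH.
Qed.

Lemma sign_mean_lin f g s (k l : R) :
  sign_mean (fun z => k * f z + l * g z) s =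
  k * sign_mean f s + l * sign_mean g s.
Proof.
elim: s f g => [|a s IH] f g //=.
by rewrite !IH; ring.
Qed.

Lemma sign_mean_cst (k : R) s : sign_mean (fun=> k) s = k.
Proof. by elim: s => [//|a s IH] /=; rewrite IH; field. Qed.

Lemma sign_meanN f s : sign_mean (fun z => f (- z)) s = sign_mean f s.
Proof.
elim: s f => [|a s IH] f /=; first by rewrite oppr0.
rewrite -(IH (fun z => f (a + z))) -(IH (fun z => f (- a + z))) addrC.
by congr ((_ + _) / _); apply: sign_mean_ext => z; congr f; ring.
Qed.

Lemma sign_mean_cat f s1 s2 : sign_mean f (s1 ++ s2) =
  sign_mean (fun z => sign_mean (fun y => f (z + y)) s2) s1.
Proof.
elim: s1 f => [|a s IH] f /=; first by apply: sign_mean_ext => z; rewrite add0r.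
rewrite !IH; congr ((_ + _) / _); apply: sign_mean_ext => z;
by apply: sign_mean_ext => y; rewrite addrA.
Qed.

Lemma sign_mean_sqr s (k : R) :
  sign_mean (fun z => (k + z) ^+ 2) s = k ^+ 2 + \sum_(a <- s) a ^+ 2.
Proof.
elim: s k => [|a s IH] k /=; first by rewrite big_nil !addr0.
rewrite (@sign_mean_ext _ (fun z => ((k + a) + z) ^+ 2)); last first.
  by move=> z; rewrite addrA.
rewrite (@sign_mean_ext (fun z => (k + (- a + z)) ^+ 2)
  (fun z => ((k - a) + z) ^+ 2)); last by move=> z; rewrite addrA.
by rewrite !IH big_cons; field.
Qed.

(** Khintchine for the fourth moment, shifted by [k] so that the induction closes: the average of
    the bounds at [k + a] and [k - a] falls short of the claim by exactly [2 * a ^+ 4]. *)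
Lemma sign_mean_pow4 s (k : R) : sign_mean (fun z => (k + z) ^+ 4) s <=
  k ^+ 4 + 6 * k ^+ 2 * (\sum_(a <- s) a ^+ 2) + 3 * (\sum_(a <- s) a ^+ 2) ^+ 2.
Proof.
elim: s k => [|a s IH] k /=; first by rewrite big_nil; lra.
rewrite (@sign_mean_ext _ (fun z => ((k + a) + z) ^+ 4)); last first.
  by move=> z; rewrite addrA.
rewrite (@sign_mean_ext (fun z => (k + (- a + z)) ^+ 4)
  (fun z => ((k - a) + z) ^+ 4)); last by move=> z; rewrite addrA.
rewrite big_cons; set S := \sum_(_ <- s) _.
have := IH (k + a); have := IH (k - a); rewrite -/S => h1 h2.
have a4 : 0 <= a ^+ 4 by rewrite -[4%N]/(2 * 2)%N exprM sqr_ge0.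
rewrite ler_pdivrMr//; apply: (le_trans (lerD h2 h1)).
rewrite -subr_ge0; apply: (le_trans (mulr_ge0 (ler0n _ 4) a4)).
by rewrite le_eqVlt; apply/orP; left; apply/eqP; ring.
Qed.

Definition sign_tail s (t : R) : R := sign_mean (fun z => (t <= z)%R%:R) s.

(** The signs of the two blocks are independent, and the whole sum passes [t1 + t2] once each block
    passes its own threshold. *)
Lemma sign_tail_cat s1 s2 t1 t2 :
  sign_tail s1 t1 * sign_tail s2 t2 <= sign_tail (s1 ++ s2) (t1 + t2).
Proof.
rewrite /sign_tail sign_mean_cat.
rewrite mulrC -[leLHS]addr0 -[X in _ + X](mul0r (sign_mean (fun=> 0) s1)).
rewrite -sign_mean_lin; apply: le_sign_mean => z; rewrite mul0r addr0.
have [t1z|t1z] := boolP (t1 <= z); last first.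
  by rewrite mulr0 -[leLHS](sign_mean_cst 0 s2); exact: le_sign_mean.
rewrite mulr1; apply: le_sign_mean => y; rewrite ler_nat.
by have [t2y|//] := boolP (t2 <= y); rewrite lerD.
Qed.

(* Paley-Zygmund with the quadratic (y - 1/4) (7 - y) in y = z ^ 2 / S, which is
   at most 729/64 everywhere and nonpositive for y <= 1/4. *)
Lemma sign_tail_block s (t : R) : 0 <= t ->
  4 * t ^+ 2 <= \sum_(a <- s) a ^+ 2 -> 10^-1 <= sign_tail s t.
Proof.
move=> t0 tS; set S := \sum_(a <- s) a ^+ 2 in tS *.
have S0 : 0 <= S by apply: sumr_ge0 => a _; exact: sqr_ge0.
pose f z : R := (t <= z)%R%:R.
(* By symmetry twice the one-sided tail dominates the probability of [t <= |z|], which is what the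
   second and fourth moments control. *)
have fE : 2 * sign_tail s t = sign_mean (fun z => 1 * f z + 1 * f (- z)) s.
  by rewrite sign_mean_lin (sign_meanN f) /sign_tail -/f; ring.
have [SE|SN0] := eqVneq S 0.
  have t_0 : t = 0 by apply/eqP; rewrite -sqrf_eq0; apply/eqP; have := sqr_ge0 t; lra.
  suff : 1 <= 2 * sign_tail s t by lra.
  rewrite fE -[leLHS](sign_mean_cst 1 s); apply: le_sign_mean => z.
  rewrite /f t_0 !mul1r; have [//|z0] := leP 0 z; first by rewrite lerDl ler0n.
  by rewrite oppr_ge0 (ltW z0) mulr0n add0r.
have Sgt0 : 0 < S by rewrite lt_def SN0.
(* The factor 64/729 normalises the maximum of [g], reached at [z ^+ 2 = 29 / 8 * S], to
   [S ^+ 2]. *)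
pose g z : R := 64 / 729 * ((z ^+ 2 - S / 4) * (7 * S - z ^+ 2)).
have gf z : g z <= S ^+ 2 * (1 * f z + 1 * f (- z)).
  have f0 : 0 <= f z + f (- z) by rewrite addr_ge0 ?ler0n.
  rewrite !mul1r /g; have [zt|zt] := leP t `|z|.
    have f1 : 1 <= f z + f (- z).
      move: zt; rewrite ler_normr /f => /orP[] ->.
        by rewrite lerDl ler0n.
      by rewrite lerDr ler0n.
    have {}f1 : S ^+ 2 <= S ^+ 2 * (f z + f (- z)) by rewrite ler_peMr// sqr_ge0.
    apply: le_trans f1; have := sqr_ge0 (z ^+ 2 - 29 / 8 * S).
    have -> : (z ^+ 2 - S / 4) * (7 * S - z ^+ 2) =
      729 / 64 * S ^+ 2 - (z ^+ 2 - 29 / 8 * S) ^+ 2 by field.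
    by lra.
  have zS : z ^+ 2 <= S / 4.
    have : z ^+ 2 <= t ^+ 2 by rewrite -(real_normK (num_real z)) ler_sqr ?nnegrE// ltW.
    lra.
  apply: le_trans (mulr_ge0 (sqr_ge0 S) f0).
  have c0 : 0 < 64 / 729 :> R by lra.
  by rewrite (pmulr_rle0 _ c0); apply: mulr_le0_ge0; lra.
(* A second moment [S] and a fourth moment at most [3 * S ^+ 2] give 64/729 times 29/4 - 3 - 7/4 =
   5/2; half of 160/729 still exceeds 1/10. *)
have gE : sign_mean g s >= 160 / 729 * S ^+ 2.
  have -> : sign_mean g s = - (64 / 729) * sign_mean (fun z => (0 + z) ^+ 4) s +
     1 * sign_mean (fun z => (64 / 729 * (29 / 4 * S)) * (0 + z) ^+ 2 +
       1 * (- (64 / 729 * (7 / 4 * S ^+ 2)))) s.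
    by rewrite -sign_mean_lin; apply: sign_mean_ext => z; rewrite /g; field.
  rewrite sign_mean_lin sign_mean_sqr sign_mean_cst -/S.
  have := sign_mean_pow4 s 0; rewrite -/S; lra.
have : S ^+ 2 * (2 * sign_tail s t) >= 160 / 729 * S ^+ 2.
  rewrite fE; apply: (le_trans gE); apply: (le_trans (le_sign_mean s gf)).
  rewrite -[leRHS]addr0 -[X in _ + X](mul0r (sign_mean (fun=> 0) s)) -sign_mean_lin.
  by apply: le_sign_mean => z; rewrite mul0r addr0.
rewrite [leLHS]mulrC ler_pM2l ?exprn_gt0//; lra.
Qed.

(** Cauchy-Schwarz, obtained by expanding the nonnegative sum of the squares of [b * |a| - A] and
    dividing by [b]. *)
Lemma sum_norm_le_sqrt s (b : R) : 0 < b -> (size s)%:R <= b ->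
  (\sum_(a <- s) `|a|) ^+ 2 <= b * \sum_(a <- s) a ^+ 2.
Proof.
move=> b0 sb; set A := \sum_(a <- s) `|a|; set S := \sum_(a <- s) _.
have : 0 <= \sum_(a <- s) (b * `|a| - A) ^+ 2.
  by apply: sumr_ge0 => a _; exact: sqr_ge0.
have -> : \sum_(a <- s) (b * `|a| - A) ^+ 2 =
    b ^+ 2 * S - 2 * b * A * A + (size s)%:R * A ^+ 2.
  rewrite (eq_bigr (fun a => b ^+ 2 * a ^+ 2 - 2 * b * A * `|a| + A ^+ 2)).
    rewrite !big_split/= sumrN; congr (_ - _ + _); [by rewrite -mulr_sumr..|].
    by rewrite big_const_seq count_predT iter_addr_0 mulr_natl.
  by move=> a _; rewrite -(real_normK (num_real a)); ring.
have A2 := sqr_ge0 A; have := ler_wpM2r A2 sb => h1 h2.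
have : 0 <= b * (b * S - A ^+ 2) by lra.
by rewrite pmulr_rge0// subr_ge0.
Qed.

(* Cutting [s] into [m] blocks of length at most [b], the events that each block
   sum exceeds half of its l2-norm are independent of probability >= 1/10. *)
Lemma sign_tail_l1 m (b : nat) s : (0 < b)%N -> (size s <= m * b)%N ->
  10^-1 ^+ m <= sign_tail s ((\sum_(a <- s) `|a|) / (2 * Num.sqrt b%:R)).
Proof.
move=> b0; have b0' : (0 : R) < b%:R by rewrite ltr0n.
elim: m s => [|m IH] s.
  rewrite mul0n leqn0 size_eq0 => /eqP ->.
  by rewrite /sign_tail/= big_nil mul0r lexx.
move=> sm.
have : (size (take b s) <= b)%N by rewrite size_take; case: ltnP.
have : (size (drop b s) <= m * b)%N by rewrite size_drop leq_subLR -mulSn.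
rewrite -[in 10^-1 ^+ _ <= _](cat_take_drop b s).
move: (take b s) (drop b s) => s1 s2 s2b s1b.
rewrite big_cat/= mulrDl exprS; apply: le_trans (sign_tail_cat _ _ _ _).
apply: ler_pM => //; last exact: IH.
apply: sign_tail_block.
  by rewrite divr_ge0 ?mulr_ge0 ?sqrtr_ge0// sumr_ge0.
rewrite expr_div_n exprMn sqr_sqrtr ?(ltW b0')//.
rewrite [leLHS](_ : _ = (\sum_(a <- s1) `|a|) ^+ 2 / b%:R); last first.
  by field; rewrite gt_eqF.
rewrite ler_pdivrMr// mulrC; apply: sum_norm_le_sqrt => //.
by rewrite ler_nat.
Qed.

End sign_means.

(** * Sign flips of measures on tuples *)

Section tuples.
Context {d} {T : measurableType d} {R : realType} {n : nat}.

Definition box (A : 'I_n -> set T) : set (n.-tuple T) :=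
  [set t | forall i, A i (tnth t i)].

Lemma measurable_box (A : 'I_n -> set T) :
  (forall i, measurable (A i)) -> measurable (box A).
Proof.
move=> mA; rewrite (_ : box A = \bigcap_(i in [set: 'I_n])
    ((@tnth n T)^~ i @^-1` A i)); last first.
  by apply/seteqP; split => [t ? i _|t At i]; [|exact: At].
apply: fin_bigcap_measurable; first exact: finite_finset.
by move=> i _; rewrite -[X in measurable X]setTI; exact: measurable_tnth.
Qed.

(** Boxes form a pi-system that contains the whole space and generates the product sigma-algebra. *)
Lemma box_measure_unique (m1 m2 : {measure set (n.-tuple T) -> \bar R}) :
  (forall A, (forall i, measurable (A i)) -> m1 (box A) = m2 (box A)) ->
  (m1 setT < +oo)%E -> forall B, measurable B -> m1 B = m2 B.
Proof.
move=> m12 m1oo B mB.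
pose G := [set box A | A in [set A : 'I_n -> set T | forall i, measurable (A i)]].
have boxT : box (fun=> setT) = setT by apply/seteqP; split.
apply: (measure_unique G (fun=> setT)) => //.
- apply/seteqP; split; last first.
    apply: smallest_sub; first exact: sigma_algebra_measurable.
    by move=> _ [A mA <-]; exact: measurable_box.
  apply: smallest_sub; first exact: smallest_sigma_algebra.
  move=> A; rewrite -bigcup_seq => -[i _ [C mC <-]].
  apply: sub_sigma_algebra; exists (fun j => if j == i then C else setT).
    by move=> j; case: ifP.
  apply/seteqP; split => [t /(_ i)|t [_ tC] j] /=; first by rewrite eqxx.
  by case: eqP => // ->.
- move=> _ _ [A mA <-] [C mC <-]; exists (fun i => A i `&` C i).
    by move=> i; exact: measurableI.
  apply/seteqP; split => [t AC|t [tA tC] i]; last by split.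
  by split=> i; have [] := AC i.
- by move=> _; exists (fun=> setT).
- exact: bigcup_const.
- by move=> _ [A mA <-]; exact: m12.
Qed.

End tuples.

Section sign_flips.
Context {R : realType} {n : nat}.
Implicit Types (e : n.-tuple bool) (t : n.-tuple R).

Definition flip e t : n.-tuple R :=
  [tuple (-1) ^+ tnth e i * tnth t i | i < n].

Lemma measurable_flip e : measurable_fun setT (flip e).
Proof.
apply/measurable_fun_tnthP => i.
rewrite (_ : _ \o _ = fun t => (-1) ^+ tnth e i * tnth t i); last first.
  by apply/funext => t /=; rewrite tnth_mktuple.
by apply: measurable_funM => //; exact: measurable_tnth.
Qed.

(** A flip reflects some sides of a box, so [m] and its image agree on boxes. The marginals [mi] are
    bare set functions so that the lemma covers both the law of a row and Lebesgue measure on a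
    cube. *)
Lemma flip_box_measure (m : {measure set (n.-tuple R) -> \bar R})
    (mi : 'I_n -> set R -> \bar R) :
  (m setT < +oo)%E ->
  (forall A, (forall i, measurable (A i)) -> m (box A) = (\prod_i mi i (A i))%E) ->
  (forall i (A : set R), measurable A -> mi i ((fun x : R => - x) @^-1` A) = mi i A) ->
  forall e B, measurable B -> m (flip e @^-1` B) = m B.
Proof.
move=> moo mbox miN e B mB.
have h := @box_measure_unique _ _ _ _ m (pushforward m (flip e)).
apply/esym/(h (measurable_flip e)) => // A mA.
have flipA : flip e @^-1` box A =
    box (fun i => if tnth e i then (fun x : R => - x) @^-1` A i else A i).
  by apply/seteqP; split=> t /= At i; have := At i; rewrite ?tnth_mktuple;
    case: (tnth e i) => /=; rewrite ?mulN1r ?mul1r.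
rewrite [RHS](_ : _ = m (flip e @^-1` box A))// flipA !mbox//; last first.
  move=> i; case: ifP => // _; rewrite -[X in measurable X]setTI.
  exact: (@oppr_measurable _ setT).
by apply: eq_bigr => i _; case: ifP => // _; rewrite miN.
Qed.

(** Conditioning on absolute values: if a proportion [p] of the flips of each point of [W] falls in
    [B], integrate this over [W]; each of the [2 ^+ n] flipped copies of [B] has measure [m B]. *)
Lemma flip_average (m : {measure set (n.-tuple R) -> \bar R}) (p : R)
    (W B : set (n.-tuple R)) :
  measurable W -> measurable B ->
  (forall e, m (flip e @^-1` B) = m B) -> 0 <= p ->
  (forall t, W t -> p * 2 ^+ n <= \sum_(e : n.-tuple bool) \1_B (flip e t)) ->
  (p%:E * m W <= m B)%E.
Proof.
move=> mW mB mfl p0 WB.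
have mfB e : measurable (flip e @^-1` B).
  by rewrite -[X in measurable X]setTI; exact: measurable_flip.
have n2 : (0 : R) < 2 ^+ n by rewrite exprn_gt0.
have : (\int[m]_t ((p * 2 ^+ n) * \1_W t)%:E <=
    \int[m]_t \sum_(e : n.-tuple bool) (\1_(flip e @^-1` B) t)%:E)%E.
  apply: ge0_le_integral => //.
  - by move=> t _; rewrite lee_fin !mulr_ge0// ltW.
  - by apply/measurable_EFinP; apply: measurable_funM => //; exact: measurable_indic.
  - apply: emeasurable_sum => e; apply/measurable_EFinP.
    exact: measurable_indic.
  move=> t _; rewrite sumEFin lee_fin.
  have [tW|tW] := boolP (t \in W); last first.
    by rewrite indicE (negbTE tW) mulr0 sumr_ge0.
  rewrite indicE tW mulr1; apply: (le_trans (WB t _)); first by rewrite inE in tW.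
  by apply: ler_sum => e _; rewrite !indicE.
under eq_integral do rewrite EFinM.
rewrite ge0_integralZl_EFin//; last 2 first.
- by apply/measurable_EFinP; exact: measurable_indic.
- by rewrite mulr_ge0// ltW.
rewrite integral_indic// setIT ge0_integral_sum//; last first.
  by move=> e; apply/measurable_EFinP; exact: measurable_indic.
rewrite (eq_bigr (fun=> m B)); last first.
  by move=> e _; rewrite integral_indic// setIT mfl.
rewrite big_const iter_addr_0 card_tuple card_bool.
rewrite -[(m B *+ _)%R]/(m B *+ _)%E -mule_natl natrX mulrC EFinM.
by rewrite -muleA lee_pmul2l.
Qed.

End sign_flips.

(** Translates between the recursive mean and sums over sign tuples, by splitting a tuple into its
    head and its tail. *)
Lemma sum_sign_mean (R : realType) (f : R -> R) n (a : 'I_n -> R) :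
  \sum_(e : n.-tuple bool) f (\sum_i (-1) ^+ tnth e i * a i) =
  2 ^+ n * sign_mean f [seq a i | i <- enum 'I_n].
Proof.
elim: n f a => [|n IH] f a.
  rewrite enum_ord0/= expr0 mul1r (big_pred1 [tuple])/= ?big_ord0//.
  by move=> e; apply/esym/eqP; exact: tuple0.
rewrite (reindex (fun p : bool * n.-tuple bool => cons_tuple p.1 p.2)); last first.
  exists (fun e => (thead e, behead_tuple e)) => [[b e] _|e _] /=.
    by congr pair; exact/val_inj.
  by rewrite [RHS]tuple_eta; exact/val_inj.
have -> : \sum_(p : bool * n.-tuple bool)
    f (\sum_i (-1) ^+ tnth (cons_tuple p.1 p.2) i * a i) =
  \sum_(b : bool) \sum_(e : n.-tuple bool)
    f ((-1) ^+ b * a ord0 + \sum_i (-1) ^+ tnth e i * a (lift ord0 i)).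
  rewrite pair_bigA/=; apply: eq_bigr => -[b e] _ /=.
  rewrite big_ord_recl/=; congr (f (_ + _)).
  by apply: eq_bigr => i _; rewrite tnthS.
rewrite big_bool/=.
rewrite (IH (fun z => f ((-1) ^+ true * a ord0 + z)) (fun i => a (lift ord0 i))).
rewrite (IH (fun z => f ((-1) ^+ false * a ord0 + z)) (fun i => a (lift ord0 i))).
by rewrite enum_ordSl/= -map_comp/= mulN1r mul1r exprS; field.
Qed.

(** * Independent rows *)

Lemma measure_bigsetU_le d (T : measurableType d) (R : realType)
    (mu : {measure set T -> \bar R}) (I : Type) (s : seq I) (Q : pred I)
    (A : I -> set T) :
  (forall i, Q i -> measurable (A i)) ->
  (mu (\big[setU/set0]_(i <- s | Q i) A i) <= \sum_(i <- s | Q i) mu (A i))%E.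
Proof.
move=> mA; elim: s => [|i s IH]; first by rewrite !big_nil measure0.
rewrite !big_cons; case: ifP => // Qi.
apply: (le_trans (measureU2 _ _ _)); [exact: mA|exact: bigsetU_measurable|].
by rewrite leeD2l.
Qed.

Section independent_rows.
Context d (T : measurableType d) (R : realType) (P : probability T R).
Context (N n : nat) (xi : 'I_N -> 'I_n -> {RV P >-> R}).

Definition row_tuple (X : 'I_n -> {RV P >-> R}) (w : T) : n.-tuple R :=
  [tuple X j w | j < n].

Lemma measurable_row_tuple X : measurable_fun setT (row_tuple X).
Proof.
apply/measurable_fun_tnthP => j.
by rewrite (_ : _ \o _ = X j)//; apply/funext => w /=; rewrite tnth_mktuple.
Qed.

Lemma measurable_row_preimage X (B : set (n.-tuple R)) :
  measurable B -> measurable (row_tuple X @^-1` B).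
Proof.
by move=> mB; rewrite -[X in measurable X]setTI; exact: measurable_row_tuple.
Qed.

Lemma row_preimage_box X (A : 'I_n -> set R) :
  row_tuple X @^-1` box A = \bigcap_(j in [set: 'I_n]) (X j @^-1` A j).
Proof.
apply/seteqP; split => w /= wA j; last by rewrite tnth_mktuple; exact: wA.
by move=> _; have := wA j; rewrite tnth_mktuple.
Qed.

Hypothesis xi_indep :
  mutually_independent (fun ij : 'I_N * 'I_n => xi ij.1 ij.2).

Lemma row_box i (A : 'I_n -> set R) : (forall j, measurable (A j)) ->
  P (row_tuple (xi i) @^-1` box A) = (\prod_j P (xi i j @^-1` A j))%E.
Proof.
move=> mA; rewrite row_preimage_box.
have := xi_indep (finset (fun ij => ij.1 == i)) (A := fun ij => A ij.2) (fun ij => mA ij.2).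
rewrite (_ : \bigcap_(_ in _) _ = \bigcap_(j in [set: 'I_n]) (xi i j @^-1` A j)).
  move=> ->; rewrite (reindex_onto (fun j => (i, j)) snd)/=; last first.
    by move=> [i' j]; rewrite inE/= => /eqP ->.
  by apply: eq_bigl => j; rewrite !inE/= !eqxx.
apply/seteqP; split => w /= wA.
- by move=> j _; have := wA (i, j); rewrite /= inE; apply.
- by move=> [i' j]; rewrite /= inE => /eqP/= ->; exact: wA.
Qed.

(** Independence of the entries gives the product formula when every [B i] is a box. Boxes are then
    replaced by arbitrary sets one row at a time, by uniqueness of measures. *)
Lemma rows_independent (B : 'I_N -> set (n.-tuple R)) :
  (forall i, measurable (B i)) ->
  P (\bigcap_(i in [set: 'I_N]) (row_tuple (xi i) @^-1` B i)) =
  (\prod_i P (row_tuple (xi i) @^-1` B i))%E.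
Proof.
have fP (E : set T) : measurable E -> P E = (fine (P E))%:E.
  by move=> mE; rewrite fineK// fin_num_measure.
(* Rows of index less than [k] carry arbitrary sets, the others boxes: [k = 0] is the independence
   of the entries and [k = N] is the goal. *)
suff claim k : (k <= N)%N -> forall B : 'I_N -> set (n.-tuple R),
    (forall i, measurable (B i)) ->
    (forall i : 'I_N, (k <= i)%N -> exists2 A : 'I_n -> set R,
      (forall j, measurable (A j)) & B i = box A) ->
    P (\bigcap_(i in [set: 'I_N]) (row_tuple (xi i) @^-1` B i)) =
    (\prod_i P (row_tuple (xi i) @^-1` B i))%E.
  move=> mB; apply: (claim N) => // i; rewrite leqNgt ltn_ord//.
elim: k => [_|k IH kN] {}B mB boxB.
  have /choice[A AE] : forall i, exists A : 'I_n -> set R,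
      (forall j, measurable (A j)) /\ B i = box A.
    by move=> i; have [A ? ?] := boxB i isT; exists A.
  have := xi_indep [set: 'I_N * 'I_n]%SET (A := fun ij => A ij.1 ij.2)
    (fun ij => (AE ij.1).1 ij.2).
  rewrite (_ : \bigcap_(_ in _) _ =
      \bigcap_(i in [set: 'I_N]) (row_tuple (xi i) @^-1` B i)).
    move=> ->; rewrite (eq_bigl xpredT); last by move=> ?; rewrite inE.
    rewrite -(pair_bigA _ (fun i j => P (xi i j @^-1` A i j)))/=.
    by apply: eq_bigr => i _; rewrite (AE i).2 row_box//; exact: (AE i).1.
  apply/seteqP; split => w /= wA.
  - by move=> i _; rewrite (AE i).2 row_preimage_box => j _; apply: (wA (i, j)); rewrite /= inE.
  - by move=> [i j] _; have := wA i I; rewrite (AE i).2 row_preimage_box; apply.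
pose i0 := Ordinal kN.
pose F := \bigcap_(i in [set i | i != i0]) (row_tuple (xi i) @^-1` B i).
have mF : measurable F.
  apply: fin_bigcap_measurable; first exact: finite_finset.
  by move=> i _; exact: measurable_row_preimage.
(* As functions of the set [C] imposed on row [i0], the left side is the law of this row under [P]
   restricted to [F], and the right side is a multiple [q] of its law under [P]. *)
pose upd C i := if i == i0 then C else B i.
have updE C : P (\bigcap_(i in [set: 'I_N]) (row_tuple (xi i) @^-1` upd C i)) =
    pushforward (mrestr P mF) (row_tuple (xi i0)) C.
  rewrite /pushforward /mrestr; congr (P _); apply/seteqP; split => w /=.
    move=> wU; split; first by have := wU i0 I; rewrite /upd/= eqxx.
    by move=> i /= ii0; have := wU i I; rewrite /upd (negbTE ii0).
  by move=> [wC wF] i _; rewrite /upd; case: eqP => [->//|/eqP]; exact: wF.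
pose q := \prod_(i | i != i0) fine (P (row_tuple (xi i) @^-1` B i)).
have q0 : 0 <= q by apply: prodr_ge0 => i _; rewrite fine_ge0.
have mr := measurable_row_tuple (xi i0).
have prodE C : measurable C ->
    (\prod_i P (row_tuple (xi i) @^-1` upd C i))%E =
    mscale (NngNum q0)
      (measure_function_pushforward__canonical__measure_function_Measure P mr) C.
  move=> mC; rewrite (bigD1 i0)//= /mscale/= muleC /pushforward {2}/upd eqxx.
  congr (_ * _)%E; rewrite /= /q -prodEFin; apply: eq_bigr => i ii0.
  by rewrite /upd (negbTE ii0) -fP//; exact: measurable_row_preimage.
have updB : upd (B i0) = B by apply/funext => i; rewrite /upd; case: eqP => // ->.
rewrite -updB updE prodE//.
have h := @box_measure_unique _ _ _ _ (pushforward (mrestr P mF) (row_tuple (xi i0)))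
  (mscale (NngNum q0)
    (measure_function_pushforward__canonical__measure_function_Measure P mr)).
apply: (h mr) => //.
- move=> A mA; have mbA : measurable (box A) by exact: measurable_box.
  rewrite -[LHS]updE -[RHS]prodE//; apply: IH; first exact: ltnW.
    by move=> i; rewrite /upd; case: ifP.
  move=> i; rewrite leq_eqVlt => /orP[/eqP ki|ki].
    by exists A => //; rewrite /upd (_ : i == i0)//; apply/eqP/val_inj.
  rewrite /upd ifF; first exact: boxB.
  by apply/eqP => ii0; rewrite ii0 ltnn in ki.
- apply: (@le_lt_trans _ _ 1%E); last exact: ltry.
  apply: probability_le1; apply: measurableI => //.
  exact: measurable_row_preimage.
Qed.

(** Chernoff's bound through the expectation of [expR (- count)], which factors over the rows. It is
    written as a finite sum over the set [J] of successful rows. *)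
Lemma row_count_chernoff (B : 'I_N -> set (n.-tuple R)) (p k : R) :
  (forall i, measurable (B i)) -> 0 <= p ->
  (forall i, (p%:E <= P (row_tuple (xi i) @^-1` B i))%E) ->
  (P [set w | (\sum_i \1_(B i) (row_tuple (xi i) w) < k)%R] <=
     (expR (k - p * N%:R / 2))%:E)%E.
Proof.
move=> mB p0 pB.
pose E i := row_tuple (xi i) @^-1` B i.
have mE i : measurable (E i) by exact: measurable_row_preimage.
pose Pi i := fine (P (E i)).
have PiE i : P (E i) = (Pi i)%:E by rewrite fineK// fin_num_measure.
have Pi0 i : 0 <= Pi i by rewrite fine_ge0.
have Pi1 i : Pi i <= 1 by rewrite -lee_fin -PiE probability_le1.
pose pat (J : {set 'I_N}) :=
  \bigcap_(i in [set: 'I_N]) (row_tuple (xi i) @^-1` (if i \in J then B i else ~` B i)).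
have patm (J : {set 'I_N}) : measurable (pat J).
  apply: fin_bigcap_measurable; first exact: finite_finset.
  move=> i _; apply: measurable_row_preimage.
  by case: ifP => // _; exact: measurableC.
have patE (J : {set 'I_N}) :
    P (pat J) = (\prod_i (if i \in J then Pi i else 1 - Pi i))%:E.
  rewrite /pat rows_independent; last by move=> i; case: ifP => // _; exact: measurableC.
  rewrite -prodEFin; apply: eq_bigr => i _; case: ifP => _; first exact: PiE.
  by rewrite [LHS](_ : _ = P (~` E i))// probability_setC// EFinB -PiE.
rewrite (_ : [set w | _] = \big[setU/set0]_(J : {set 'I_N} | (#|J|%:R < k)%R) pat J); last first.
  rewrite -bigcup_seq_cond; apply/seteqP; split => w /=.
    move=> wk; exists (finset (fun i => `[< B i (row_tuple (xi i) w) >])).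
      rewrite /= mem_index_enum /=; apply: le_lt_trans wk.
      rewrite -sum1_card natr_sum big_mkcond/=; apply: ler_sum => i _.
      rewrite inE indicE; case: asboolP => [h|_]; last exact: ler0n.
      by rewrite mem_set.
    by move=> i _ /=; rewrite inE; case: asboolP.
  move=> [J /= /andP[_ Jk] wJ]; apply: le_lt_trans Jk.
  rewrite -sum1_card natr_sum [leRHS]big_mkcond/=; apply: ler_sum => i _.
  have := wJ i I; rewrite /= indicE; case: ifP => _ //= h; first by rewrite lern1 leq_b1.
  by rewrite memNset.
apply: (le_trans (measure_bigsetU_le _ _ _)) => //.
rewrite (eq_bigr _ (fun J _ => patE J)) sumEFin lee_fin.
(* The weight [expR (k - #|J|)] is at least 1 when [#|J| < k]; with it the sum can be extended to
   all [J], where it becomes a product over the rows. *)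
apply: (@le_trans _ _ (\sum_(J in {set 'I_N}) expR k *
   \prod_i (if i \in J then expR (-1) * Pi i else 1 - Pi i))).
  rewrite big_mkcond/=; apply: ler_sum => J _.
  have pr0 : 0 <= \prod_i (if i \in J then Pi i else 1 - Pi i).
    by apply: prodr_ge0 => i _; case: ifP => // _; rewrite subr_ge0.
  have -> : \prod_i (if i \in J then expR (-1) * Pi i else 1 - Pi i) =
      expR (- #|J|%:R) * \prod_i (if i \in J then Pi i else 1 - Pi i).
    rewrite (_ : - #|J|%:R = -1 * #|J|%:R :> R); last by rewrite mulN1r.
    rewrite expRM_natr -prodr_const [X in X * _]big_mkcond -big_split/=.
    by apply: eq_bigr => i _; case: ifP => // _; rewrite mul1r.
  case: ifP => Jk; last by rewrite !mulr_ge0 ?expR_ge0.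
  rewrite mulrA -expRD ler_peMl// -[leLHS]expR0 ler_expR subr_ge0.
  exact: ltW.
rewrite -big_distrr/= -bigA_distr/= expRD ler_pM2l ?expR_gt0//.
apply: (@le_trans _ _ (\prod_(i < N) expR (- (p / 2)))); last first.
  rewrite prodr_const card_ord -expRM_natr ler_expR; lra.
apply: ler_prod => i _; apply/andP; split.
  by rewrite addr_ge0 ?mulr_ge0 ?expR_ge0 ?subr_ge0.
(* Hence each factor is at most [1 - Pi i / 2], so at most [1 - p / 2 <= expR (- (p / 2))]. *)
have e2 : expR (-1 : R) <= 2^-1.
  rewrite expRN lef_pV2 ?posrE ?expR_gt0//.
  by have := expR_ge1Dx (1 : R); lra.
have pPi : p <= Pi i by rewrite -lee_fin -PiE; exact: pB.
apply: le_trans (expR_ge1Dx _).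
have := ler_wpM2r (Pi0 i) e2; lra.
Qed.

End independent_rows.

(** * The event of one row *)

Lemma markov_measure d (T : measurableType d) (R : realType)
    (mu : {measure set T -> \bar R}) (f : T -> \bar R) (k : R) :
  measurable_fun setT f -> (forall x, 0 <= f x)%E -> 0 <= k ->
  (k%:E * mu [set x | (k%:E <= f x)%E] <= \int[mu]_x f x)%E.
Proof.
move=> mf f0 k0.
have mE : measurable [set x | (k%:E <= f x)%E].
  by rewrite -[X in measurable X]setTI; exact: emeasurable_fun_c_infty.
rewrite -[X in mu X]setIT -(integral_indic mu measurableT mE).
rewrite -ge0_integralZl_EFin//; last 1 first.
- by apply/measurable_EFinP; exact: measurable_indic.
apply: ge0_le_integral => //.
- by move=> x _; rewrite mule_ge0// lee_fin.
- apply: emeasurable_funM => //; apply/measurable_EFinP; exact: measurable_indic.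
- move=> x _; rewrite indicE; case: (boolP (x \in _)) => [|_].
    by rewrite inE/= mule1.
  by rewrite mule0.
Qed.

Section row_estimate.
Context d (T : measurableType d) (R : realType) (P : probability T R).
Context (n : nat) (X : 'I_n -> {RV P >-> R}) (u v : R).
Hypothesis u01 : 0 < u < 1.
Hypothesis v01 : 0 < v < 1.
Hypothesis X_box : forall A : 'I_n -> set R, (forall j, measurable (A j)) ->
  P (row_tuple X @^-1` box A) = (\prod_j P (X j @^-1` A j))%E.
Hypothesis X_sym : forall j, symmetric_RV P (X j).
Hypothesis X_var : forall j, 'V_P[X j] = 1%E.
Hypothesis X_conc : forall j, (concentration P (X j) u <= v%:E)%E.

Let mean j := fine 'E_P[X j].

Lemma row_flip e (B : set (n.-tuple R)) : measurable B ->
  P (row_tuple X @^-1` (flip e @^-1` B)) = P (row_tuple X @^-1` B).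
Proof.
move=> mB; have mr := measurable_row_tuple X.
pose m := measure_function_pushforward__canonical__measure_function_Measure P mr.
have moo : (m setT < +oo)%E.
  apply: (@le_lt_trans _ _ 1%E); last exact: ltry.
  by apply: probability_le1; exact: measurable_row_preimage.
apply: (@flip_box_measure R n m (fun j A => P (X j @^-1` A)) moo X_box) => // j A mA.
by rewrite [RHS]X_sym.
Qed.

(** By Chebyshev [X j] is at distance less than 2 from its mean with probability at least 3/4, and
    by symmetry so is [- X j]. Both happen together somewhere, and then the mean is less than 2 in
    absolute value. *)
Lemma abs_mean_le2 j : `|mean j| <= 2.
Proof.
pose A := [set x : R | 2 <= `|x - mean j|].
have mA : measurable A.
  rewrite -[A]setTI; apply: (@measurable_fun_le _ _ _ setT (cst 2)) => //=.
  apply: measurableT_comp => //. exact: measurable_funB.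
have PA : (P (X j @^-1` A) <= (4^-1)%:E)%E.
  have := chebyshev (X j) (ltr0n R 2); rewrite X_var mule1.
  by rewrite -natrX.
have PA' : (P ((fun w => (- X j w)%R) @^-1` A) <= (4^-1)%:E)%E by rewrite -X_sym.
have mXA : measurable (X j @^-1` A) by rewrite -[X in measurable X]setTI; exact: measurable_funPT.
have mXA' : measurable ((fun w => (- X j w)%R) @^-1` A).
  rewrite -[X in measurable X]setTI.
  by apply: measurableT_comp => //; exact: measurable_funPT.
have [//|m2] := leP `|mean j| 2; exfalso.
have : (P setT <= P (X j @^-1` A) + P ((fun w => (- X j w)%R) @^-1` A))%E.
  apply: le_trans (measureU2 _ mXA mXA'); apply: le_measure; rewrite ?inE//.
    exact: measurableU.
  move=> w _; rewrite /A /=; have [|h1] := leP 2 `|X j w - mean j|; first by left.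
  right; have [//|h2] := leP 2 `|- X j w - mean j|.
  move: (X j w : R) h1 h2 m2 => y; rewrite !ltr_norml ltr_normr.
  by move=> /andP[? ?] /andP[? ?] /orP[]; lra.
rewrite probability_setT; apply/negP; rewrite -ltNge.
by apply: (le_lt_trans (leeD PA PA')); rewrite -EFinD lte_fin; lra.
Qed.

(** The centred sum of squares has expectation [n], by the unit variances; Markov's inequality gives
    the rest. *)
Lemma row_norm_markov : (0 < n)%N -> (P [set w | 4 / (1 - v) * n%:R <=
   \sum_j (X j w - mean j) ^+ 2]%R <= ((1 - v) / 4)%:E)%E.
Proof.
move=> n0; have nR : 0 < n%:R :> R by rewrite ltr0n.
have v1 : 0 < 1 - v by case/andP: v01; lra.
have c0 : 0 < 4 / (1 - v) * n%:R by rewrite mulr_gt0 ?divr_gt0.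
have mX j : measurable_fun setT (fun w => (X j w - mean j) ^+ 2).
  by apply: measurable_funX; apply: measurable_funB.
have := @markov_measure _ _ _ P (fun w => (\sum_j (X j w - mean j) ^+ 2)%:E)
  (4 / (1 - v) * n%:R).
have -> : (\int[P]_w (\sum_j (X j w - mean j) ^+ 2)%:E = n%:R%:E)%E.
  under eq_integral do rewrite -sumEFin.
  rewrite ge0_integral_sum//; last 2 first.
  - by move=> j; exact/measurable_EFinP/mX.
  - by move=> j w _; rewrite lee_fin sqr_ge0.
  rewrite (eq_bigr (fun=> 1%E)) => [|j _].
    by rewrite sumEFin sumr_const card_ord.
  have EE (Y : T -> R) : ('E_P[Y])%E = (\int[P]_w (Y w)%:E)%E by rewrite unlock.
  by rewrite -(X_var j) /variance covariance.unlock [RHS]EE.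
move=> h; rewrite -(@lee_pmul2l _ (4 / (1 - v) * n%:R)%:E)//.
apply: le_trans (h _ _ (ltW c0)) _ => //.
- by apply/measurable_EFinP; exact: measurable_sum.
- by move=> w; rewrite lee_fin sumr_ge0// => j _; exact: sqr_ge0.
- rewrite -EFinM lee_fin le_eqVlt; apply/orP; left; apply/eqP.
  by field; rewrite gt_eqF.
Qed.

(** The weight of [x] on the entries with [|X j| <= u] has expectation at most [v] times the total,
    by the concentration bound at 0; the threshold is midway between [v] and 1. *)
Lemma row_small_ball_markov (x : 'I_n -> R) : 0 < \sum_j `|x j| ->
  (P [set w | (1 + v) / 2 * \sum_j `|x j| <=
     \sum_j `|x j| * \1_[set w | `|X j w| <= u] w]%R <= (2 * v / (1 + v))%:E)%E.
Proof.
move=> x0; set S := \sum_j _ in x0 *.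
have mA j : measurable [set w | `|X j w| <= u].
  rewrite -[X in measurable X]setTI.
  by apply: (@measurable_fun_le _ _ _ setT _ (cst u)) => //; exact: measurableT_comp.
have /andP[v0 v1] := v01.
have mI j : measurable_fun setT (\1_[set w | `|X j w| <= u] : T -> R).
  exact: measurable_indic.
have c0 : 0 < (1 + v) / 2 * S by rewrite mulr_gt0//; lra.
have := @markov_measure _ _ _ P
  (fun w => (\sum_j `|x j| * \1_[set w | `|X j w| <= u] w)%:E) ((1 + v) / 2 * S).
have : (\int[P]_w (\sum_j `|x j| * \1_[set w | `|X j w| <= u]%R w)%:E <= (v * S)%:E)%E.
  under eq_integral do rewrite -sumEFin.
  rewrite ge0_integral_sum//; last first.
    move=> j; apply/measurable_EFinP; apply: measurable_funM; first exact: measurable_cst.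
    exact: mI.
  rewrite mulr_sumr -sumEFin; apply: lee_sum => j _.
  under eq_integral do rewrite EFinM.
  rewrite ge0_integralZl_EFin//; last exact/measurable_EFinP/mI.
  rewrite integral_indic// setIT mulrC EFinM.
  apply: lee_wpmul2l; first by rewrite lee_fin.
  apply: le_trans (X_conc j); apply: ereal_sup_ubound; exists 0 => //=.
  by congr (P _); apply/seteqP; split => w /=; rewrite subr0.
move=> h1 h; rewrite -(@lee_pmul2l _ ((1 + v) / 2 * S)%:E)//.
apply: le_trans (le_trans (h _ _ (ltW c0)) h1) _ => //.
- apply/measurable_EFinP; apply: measurable_sum => j; apply: measurable_funM;
    first exact: measurable_cst.
  exact: mI.
- by move=> w; rewrite lee_fin sumr_ge0// => j _; rewrite mulr_ge0.
- rewrite -EFinM lee_fin le_eqVlt; apply/orP; left; apply/eqP.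
  by field; apply/eqP; lra.
Qed.

End row_estimate.

Lemma measurable_gt_set d (T : measurableType d) (R : realType) (f : T -> R) k :
  measurable_fun setT f -> measurable [set x | k < f x].
Proof.
move=> mf; rewrite -[X in measurable X]setTI.
rewrite (_ : [set x | k < f x] = f @^-1` `]k, +oo[); first exact: mf.
by apply/seteqP; split => x /=; rewrite in_itv/= andbT.
Qed.

Lemma measurable_le_set d (T : measurableType d) (R : realType) (f : T -> R) k :
  measurable_fun setT f -> measurable [set x | f x <= k].
Proof.
move=> mf; rewrite -[X in measurable X]setTI.
rewrite (_ : [set x | f x <= k] = f @^-1` `]-oo, k]); first exact: mf.
by apply/seteqP; split => x /=; rewrite in_itv.
Qed.

Lemma measurable_ge_set d (T : measurableType d) (R : realType) (f : T -> R) k :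
  measurable_fun setT f -> measurable [set x | k <= f x].
Proof.
move=> mf; rewrite -[X in measurable X]setTI.
rewrite (_ : [set x | k <= f x] = f @^-1` `[k, +oo[); first exact: mf.
by apply/seteqP; split => x /=; rewrite in_itv/= andbT.
Qed.

Section row_event.
Context {R : realType} {n : nat}.
Implicit Types (x : 'I_n -> R) (t : n.-tuple R).

(** The threshold 2 exceeds by one the bound that a point of the polar satisfies, which leaves room
    for a perturbation of [x]; the bound [K] on the row controls that perturbation. *)
Definition row_event x (K : R) : set (n.-tuple R) :=
  [set t | 2 < `|\sum_j x j * tnth t j| /\ \sum_j tnth t j ^+ 2 <= K].

Lemma measurable_dot x :
  measurable_fun setT (fun t : n.-tuple R => \sum_j x j * tnth t j).
Proof.
apply: measurable_sum => j; apply: measurable_funM;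
    first exact: measurable_cst.
exact: measurable_tnth.
Qed.

Lemma measurable_sumsq :
  measurable_fun setT (fun t : n.-tuple R => \sum_j tnth t j ^+ 2).
Proof.
by apply: measurable_sum => j; apply: measurable_funX; exact: measurable_tnth.
Qed.

Lemma measurable_row_event x K : measurable (row_event x K).
Proof.
apply: measurableI.
- apply: measurable_gt_set.
  by apply: measurableT_comp => //; exact: measurable_dot.
- by apply: measurable_le_set; exact: measurable_sumsq.
Qed.

Lemma sumsq_flip e t : \sum_j tnth (flip e t) j ^+ 2 = \sum_j tnth t j ^+ 2.
Proof. by apply: eq_bigr => j _; rewrite tnth_mktuple exprMn sqrr_sign mul1r. Qed.

Lemma dot_flip x e t :
  \sum_j x j * tnth (flip e t) j = \sum_j (-1) ^+ tnth e j * (x j * tnth t j).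
Proof. by apply: eq_bigr => j _; rewrite tnth_mktuple mulrCA. Qed.

(** Flips preserve the norm of [t] and turn its product with [x] into a Rademacher sum with
    coefficients [x j * tnth t j], to which [sign_tail_l1] applies. *)
Lemma row_event_flips x (K : R) t (m b : nat) : (0 < b)%N -> (n <= m * b)%N ->
  4 * Num.sqrt b%:R < \sum_j `|x j * tnth t j| -> \sum_j tnth t j ^+ 2 <= K ->
  10^-1 ^+ m * 2 ^+ n <=
    \sum_(e : n.-tuple bool) \1_(row_event x K) (flip e t) :> R.
Proof.
move=> b0 nmb xt tK; have sb0 : 0 < Num.sqrt b%:R :> R by rewrite sqrtr_gt0 ltr0n.
pose s := [seq x j * tnth t j | j <- enum 'I_n].
pose tau := (\sum_(a <- s) `|a|) / (2 * Num.sqrt b%:R).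
have tau2 : 2 < tau.
  rewrite /tau big_map big_enum/= ltr_pdivlMr ?mulr_gt0//.
  by rewrite mulrA -natrM.
have := sign_tail_l1 (m := m) (s := s) b0.
rewrite size_map size_enum_ord => /(_ nmb) h.
apply: (@le_trans _ _ (2 ^+ n * sign_tail s tau)).
  by rewrite mulrC ler_pM2l ?exprn_gt0.
rewrite /sign_tail -sum_sign_mean; apply: ler_sum => e _; rewrite -dot_flip indicE.
have [le|//] := leP tau; rewrite mem_set//.
split; last by rewrite sumsq_flip.
by apply: lt_le_trans tau2 _; apply: le_trans le (ler_norm _).
Qed.

End row_event.

Section row_event_probability.
Context d (T : measurableType d) (R : realType) (P : probability T R).
Context (n : nat) (X : 'I_n -> {RV P >-> R}) (u v : R).

Lemma row_event_prob (x : 'I_n -> R) (m b : nat) : 0 < u < 1 -> 0 < v < 1 ->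
  (forall A : 'I_n -> set R, (forall j, measurable (A j)) ->
    P (row_tuple X @^-1` box A) = (\prod_j P (X j @^-1` A j))%E) ->
  (forall j, symmetric_RV P (X j)) -> (forall j, 'V_P[X j] = 1%E) ->
  (forall j, (concentration P (X j) u <= v%:E)%E) ->
  (0 < n)%N -> (0 < b)%N -> (n <= m * b)%N ->
  9 * Num.sqrt b%:R / (u * (1 - v)) <= \sum_j `|x j| ->
  (((1 - v) / 4 * 10^-1 ^+ m)%:E <=
     P (row_tuple X @^-1` row_event x (16 / (1 - v) * n%:R)))%E.
Proof.
move=> u01 v01 Xbox Xsym Xvar Xconc n0 b0 nmb xS.
have /andP[u0 u1] := u01; have /andP[v0 v1] := v01.
have nR : 0 < n%:R :> R by rewrite ltr0n.
have sb0 : 0 < Num.sqrt b%:R :> R by rewrite sqrtr_gt0 ltr0n.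
have uv0 : 0 < u * (1 - v) by rewrite mulr_gt0 // subr_gt0.
pose S : R := \sum_j `|x j|; rewrite -/S in xS.
have S0 : 0 < S by apply: lt_le_trans xS; rewrite divr_gt0 // mulr_gt0.
pose K : R := 16 / (1 - v) * n%:R; rewrite -/K.
(* Off the exceptional event of [row_small_ball_markov], entries larger than [u] carry at least the
   part [(1 - v) / 2] of the weight of [x]. *)
pose W := [set t : n.-tuple R | u * (1 - v) / 2 * S <= \sum_j `|x j * tnth t j| /\
   \sum_j tnth t j ^+ 2 <= K].
have mW : measurable W.
  apply: measurableI.
  - apply: measurable_ge_set.
    apply: measurable_sum => j; apply: measurableT_comp => //.
    apply: measurable_funM; first exact: measurable_cst.
    exact: measurable_tnth.
  - apply: measurable_le_set.
    exact: measurable_sumsq.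
have mr := measurable_row_tuple X.
pose m' := measure_function_pushforward__canonical__measure_function_Measure P mr.
have PW : (((1 - v) / 4)%:E <= P (row_tuple X @^-1` W))%E.
  pose G := [set w | (1 + v) / 2 * S <=
     \sum_j `|x j| * \1_[set w | `|X j w| <= u] w].
  pose H := [set w | 4 / (1 - v) * n%:R <=
     \sum_j (X j w - fine ('E_P[X j])%E) ^+ 2].
  have mH : measurable H.
    apply: measurable_ge_set.
    apply: measurable_sum => j; apply: measurable_funX.
    exact: measurable_funB.
  have mG : measurable G.
    apply: measurable_ge_set.
    apply: measurable_sum => j; apply: measurable_funM;
    first exact: measurable_cst.
    apply: measurable_indic; apply: measurable_le_set.
    exact: measurableT_comp.
  have mWX := measurable_row_preimage X mW.
  have PG : (P G <= (2 * v / (1 + v))%:E)%E by exact: row_small_ball_markov.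
  have PH : (P H <= ((1 - v) / 4)%:E)%E by exact: row_norm_markov.
  have : (P setT <= P (row_tuple X @^-1` W) + (P G + P H))%E.
    apply: (@le_trans _ _ (P (row_tuple X @^-1` W `|` (G `|` H)))); last first.
      apply: (le_trans (measureU2 _ _ _)) => //; first exact: measurableU.
      by rewrite leeD2l// measureU2.
    apply: le_measure; rewrite ?inE//.
      by apply: measurableU => //; exact: measurableU.
    move=> w _; have [Gw|Gw] := leP ((1 + v) / 2 * S)
       (\sum_j `|x j| * \1_[set w | `|X j w| <= u] w); first by right; left.
    have [Hw|Hw] := leP (4 / (1 - v) * n%:R)
       (\sum_j (X j w - fine ('E_P[X j])%E) ^+ 2); first by right; right.
    left; split.
      apply: (@le_trans _ _ (u * \sum_j `|x j| *
          (1 - \1_[set w | `|X j w| <= u] w))).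
        rewrite (eq_bigr (fun j => `|x j| - `|x j| *
          \1_[set w | `|X j w| <= u] w)); last by move=> j _; rewrite mulrBr mulr1.
        rewrite sumrB -/S -!mulrA ler_pM2l//.
        apply: (@le_trans _ _ (S - (1 + v) / 2 * S)); first by lra.
        by rewrite lerD2l lerN2 ltW.
      rewrite mulr_sumr; apply: ler_sum => j _.
      rewrite normrM tnth_mktuple mulrCA ler_wpM2l// indicE.
      case: (boolP (w \in _)) => [_|]; first by rewrite subrr mulr0.
      rewrite notin_setE/= subr0 mulr1 => /negP; rewrite -ltNge; exact: ltW.
    (* The square of an entry is at most twice that of the centred entry plus twice that of the
       mean, and the mean is at most 2 in absolute value. *)
    apply: (@le_trans _ _ (2 * (4 / (1 - v) * n%:R) + 8 * n%:R)).
      apply: (@le_trans _ _ (2 * (\sum_j (X j w - fine ('E_P[X j])%E) ^+ 2) + 8 * n%:R));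
        last by rewrite lerD2r ler_pM2l// ltW.
      have -> : 8 * n%:R = \sum_(j < n) (8 : R).
        by rewrite sumr_const card_ord mulr_natr.
      rewrite mulr_sumr -big_split/=.
      apply: ler_sum => j _; rewrite tnth_mktuple.
      have := abs_mean_le2 Xsym Xvar j; set mj := fine _ => mj2.
      have : mj ^+ 2 <= 4.
        by rewrite -(real_normK (num_real mj)) -[4]/(2 * 2)%:R natrM -expr2 ler_sqr ?nnegrE.
      by have := sqr_ge0 ((X j w : R) - 2 * mj); lra.
    have n8 : 8 * n%:R <= 8 / (1 - v) * n%:R.
      by rewrite ler_pM2r// ler_pdivlMr ?subr_gt0//; lra.
    rewrite /K; lra.
  rewrite probability_setT => h.
  have {}h : (1 <= P (row_tuple X @^-1` W) + (2 * v / (1 + v) + (1 - v) / 4)%:E)%E.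
    by apply: (le_trans h); rewrite leeD2l// EFinD leeD.
  (* This is [4 * v <= (1 + v) ^+ 2]. It leaves [(1 - v) / 2] for [W], of which the norm event takes
     at most half. *)
  have h2 : 2 * v / (1 + v) <= 1 - (1 - v) / 2.
    by rewrite ler_pdivrMr; [have := sqr_ge0 (1 - v); lra|lra].
  have fW : P (row_tuple X @^-1` W) \is a fin_num by rewrite fin_num_measure.
  rewrite -(fineK fW) lee_fin; move: h; rewrite -(fineK fW) -EFinD lee_fin; lra.
apply: (@le_trans _ _ ((10^-1 ^+ m)%:E * m' W)%E).
  by rewrite mulrC EFinM lee_wpmul2l// lee_fin exprn_ge0// invr_ge0.
apply: flip_average => //.
- exact: measurable_row_event.
- by move=> e; apply: row_flip => //; exact: measurable_row_event.
- move=> t [tS tK]; apply: (row_event_flips (b := b)) => //.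
  (* The 9 in the hypothesis, against twice the 4 of [row_event_flips], provides the strict
     inequality. *)
  apply: (lt_le_trans _ tS); move: xS; rewrite ler_pdivrMr// => xS.
  have -> : u * (1 - v) / 2 * S = S * (u * (1 - v)) / 2 by ring.
  by rewrite ltr_pdivlMr//; lra.
Qed.

End row_event_probability.

(** * Volumes of cubes and l1-balls *)

Lemma lebesgue_measure_reflect (R : realType) (c : R) (A : set R) : measurable A ->
  lebesgue_measure ((fun r : R => c - r) @^-1` A) = lebesgue_measure A.
Proof.
move=> mA.
have mf : measurable_fun [set: measurableTypeR R]
    ((fun r => c - r) : measurableTypeR R -> measurableTypeR R).
  by apply: measurable_funB => //; exact: measurable_cst.
pose m := measure_function_pushforward__canonical__measure_function_Measure
  (@lebesgue_measure R) mf.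
apply/esym/(@lebesgue_measure_unique R m) => // _ [[a b] _ <-].
rewrite [RHS](_ : _ = lebesgue_measure [set` `[c - b, c - a[%R]); last first.
  congr (lebesgue_measure _); apply/seteqP; split => r /=; rewrite !in_itv/=;
  by move=> /andP[? ?]; apply/andP; split; lra.
rewrite !lebesgue_measure_itv/= !lte_fin ltrD2l ltrN2.
by case: ifP => // _; rewrite -!EFinB; congr (_%:E); ring.
Qed.

Lemma lebesgue_measure_itvcc (R : realType) (a b : R) : a <= b ->
  lebesgue_measure [set` `[a, b]] = (b - a)%:E.
Proof.
move=> ab; rewrite lebesgue_measure_itv/= lte_fin; case: ltP => [//|ba].
by rewrite (le_anti (introT andP (conj ab ba))) subrr.
Qed.

Section volumes.
Context {R : realType}.
Local Notation mu n := (tuple_measure (@lebesgue_measure R) n).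

Lemma cube_volume n (a b : R) : a <= b ->
  mu n (box (fun=> [set` `[a, b]])) = ((b - a) ^+ n)%:E.
Proof.
move=> ab; rewrite tuple_measure_box; last by move=> i; exact: measurable_itv.
rewrite (eq_bigr (fun=> (b - a)%:E)) => [|i _].
  by rewrite prodEFin prodr_const card_ord.
exact: lebesgue_measure_itvcc.
Qed.

Lemma sum_geometric_half n : \sum_(a < n) 2^-1 ^+ a <= 2 :> R.
Proof.
suff -> : \sum_(a < n) 2^-1 ^+ a = 2 - 2 * 2^-1 ^+ n :> R.
  by rewrite gerBl mulr_ge0// exprn_ge0// invr_ge0.
elim: n => [|n IH]; first by rewrite big_ord0 expr0; ring.
by rewrite big_ord_recr/= IH exprS; field.
Qed.

Let l1 {n} (t : n.-tuple R) : R := \sum_i `|tnth t i|.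

Lemma measurable_l1 n : measurable_fun setT (@l1 n).
Proof.
by apply: measurable_sum => i; apply: measurableT_comp => //; exact: measurable_tnth.
Qed.

(* The ball is covered by cells of side r / n indexed by the integer parts a_i of
   n |t_i| / r and the signs; as \sum a_i <= n, at most 8 ^ n cells occur, which
   is seen by giving the cell the weight 2 ^ (n - \sum a_i) >= 1. *)
Lemma l1_ball_volume n (r : R) : (0 < n)%N -> 0 < r ->
  (mu n [set t | (\sum_i `|tnth t i| <= r)%R] <= ((8 * r / n%:R) ^+ n)%:E)%E.
Proof.
move=> n0 r0; have nR : 0 < n%:R :> R by rewrite ltr0n.
pose h := r / n%:R; have h0 : 0 < h by rewrite divr_gt0.
pose I := {ffun 'I_n -> 'I_n.+1 * bool}.
pose itv (a : nat) (b : bool) : set R :=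
  if b then [set` `[h *+ a, h *+ a.+1]] else [set` `[- (h *+ a.+1), - (h *+ a)]].
have itvE a b : lebesgue_measure (itv a b) = h%:E.
  rewrite /itv; case: b; rewrite lebesgue_measure_itvcc ?mulrS ?lerN2 ?lerDr ?ltW//.
    by congr (_%:E); ring.
  by congr (_%:E); ring.
have mitv a b : measurable (itv a b) by rewrite /itv; case: b; exact: measurable_itv.
pose cell (f : I) := box (fun i => itv (f i).1 (f i).2).
have mcell f : measurable (cell f) by apply: measurable_box => i; exact: mitv.
have cellE f : mu n (cell f) = (h ^+ n)%:E.
  rewrite tuple_measure_box; last by move=> i; exact: mitv.
  rewrite (eq_bigr (fun=> h%:E)); first by rewrite prodEFin prodr_const card_ord.
  by move=> i _; exact: itvE.
have cover : [set t : n.-tuple R | \sum_i `|tnth t i| <= r] `<=`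
    \big[setU/set0]_(f : I | (\sum_i (f i).1 <= n)%N) cell f.
  move=> t /= tr; rewrite -bigcup_seq_cond.
  pose a i := Num.truncn (`|tnth t i| / h).
  have aP i : (a i)%:R <= `|tnth t i| / h < (a i).+1%:R.
    by apply: truncn_itv; rewrite divr_ge0// ltW.
  have san : (\sum_i a i <= n)%N.
    rewrite -(ler_nat R) natr_sum; apply: (@le_trans _ _ (\sum_i `|tnth t i| / h)).
      by apply: ler_sum => i _; case/andP: (aP i).
    by rewrite -mulr_suml ler_pdivrMr// mulrCA divff ?mulr1// gt_eqF.
  have an i : (a i < n.+1)%N.
    by rewrite ltnS (leq_trans _ san)// (bigD1 i)//= leq_addr.
  exists [ffun i => (Ordinal (an i), 0 <= tnth t i)].
    by rewrite /= mem_index_enum/= (eq_bigr a)// => i _; rewrite ffunE.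
  move=> i; rewrite ffunE/= /itv; have /andP[] := aP i.
  rewrite ler_pdivlMr// ltr_pdivrMr// ![_%:R * h]mulr_natl.
  have [ti|ti] := leP 0 (tnth t i); rewrite /= in_itv/= => la au; apply/andP; split.
  - by move: la; rewrite ger0_norm.
  - by move: au; rewrite ger0_norm// => /ltW.
  - by move: au; rewrite ltr0_norm// => au; rewrite lerNl ltW.
  - by move: la; rewrite ltr0_norm// => la; rewrite lerNr.
apply: (@le_trans _ _ (mu n (\big[setU/set0]_(f : I | (\sum_i (f i).1 <= n)%N) cell f))).
  apply: le_measure => //; rewrite inE.
    by apply: measurable_le_set; exact: measurable_l1.
  by apply: bigsetU_measurable => f _; exact: mcell.
apply: (le_trans (measure_bigsetU_le _ _ _)); first by move=> f _; exact: mcell.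
apply: (@le_trans _ _ (\sum_(f : I | (\sum_i (f i).1 <= n)%N) (h ^+ n)%:E)%E).
  apply: lee_sum => f _; have := lexx (h ^+ n)%:E.
  by rewrite -[X in (X <= _)%E -> _](cellE f).
rewrite sumEFin lee_fin.
apply: (@le_trans _ _ (\sum_(f : I) 2 ^+ n * h ^+ n * \prod_i 2^-1 ^+ (f i).1)).
  rewrite big_mkcond/=; apply: ler_sum => f _.
  have hn0 : 0 < h ^+ n by rewrite exprn_gt0.
  have -> : \prod_i 2^-1 ^+ (f i).1 = 2^-1 ^+ (\sum_i (f i).1)%N :> R.
    by rewrite -prodrXr.
  case: ifP => [fn|_]; last by rewrite !mulr_ge0// ?exprn_ge0// ?invr_ge0// ltW.
  rewrite mulrAC ler_peMl ?(ltW hn0)//.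
  by rewrite exprVn ler_pdivlMr ?exprn_gt0// mul1r ler_weXn2l// ler1n.
rewrite -big_distrr/= -(bigA_distr_bigA (fun (_ : 'I_n) (p : 'I_n.+1 * bool) => 2^-1 ^+ p.1))/=.
rewrite prodr_const card_ord -!exprMn ler_pXn2r ?nnegrE//; last 2 first.
- by rewrite !mulr_ge0 ?sumr_ge0// ?ltW// => p _; rewrite exprn_ge0// invr_ge0.
- by rewrite !mulr_ge0 ?invr_ge0// ltW.
have -> : \sum_(p : 'I_n.+1 * bool) 2^-1 ^+ p.1 = 2 * \sum_(a < n.+1) 2^-1 ^+ a :> R.
  rewrite -(pair_bigA _ (fun (a : 'I_n.+1) (_ : bool) => 2^-1 ^+ a))/= mulr_sumr.
  by apply: eq_bigr => a _; rewrite big_bool/=; ring.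
have := ler_wpM2l (ltW h0) (sum_geometric_half n.+1).
rewrite (_ : 8 * r / n%:R = 8 * h); last by rewrite /h mulrA.
move: (\sum_(a < n.+1) _) => z; lra.
Qed.

(** Volume version of the averaging over signs: the translate of [Y] by [x] contains at least half
    of the cube of side [2 * s] centred at [x]. *)
Lemma shifted_half_cube n (x : n.-tuple R) (s : R) (Y : set (n.-tuple R)) :
  0 <= s -> measurable Y ->
  (forall y : n.-tuple R, (forall j, `|tnth y j| <= s) ->
     2^-1 * 2 ^+ n <= \sum_(e : n.-tuple bool) \1_Y (flip e y) :> R) ->
  ((2^-1 * (2 * s) ^+ n)%:E <=
     mu n [set t | Y [tuple (tnth t j - tnth x j)%R | j < n]])%E.
Proof.
move=> s0 mY Yflip.
pose sh (t : n.-tuple R) := [tuple tnth t j - tnth x j | j < n].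
have msh : measurable_fun setT sh.
  apply/measurable_fun_tnthP => j.
  rewrite (_ : _ \o _ = fun t => tnth t j - tnth x j); last first.
    by apply/funext => t /=; rewrite tnth_mktuple.
  by apply: measurable_funB => //; exact: measurable_tnth.
pose Q : set (n.-tuple R) := box (fun=> [set` `[- s, s]]).
have mQ : measurable Q by apply: measurable_box => j; exact: measurable_itv.
have mshV C : measurable C -> measurable (sh @^-1` C).
  by move=> mC; rewrite -[X in measurable X]setTI; exact: msh.
have mshQ := mshV _ mQ.
(* Lebesgue measure on the cube centred at [x], moved to the origin; it is a product measure and
   invariant under flips. *)
pose m := measure_function_pushforward__canonical__measure_function_Measure
  (mrestr (mu n) mshQ) msh.
have mE B : m B = mu n (sh @^-1` B `&` sh @^-1` Q) by [].
pose mi (j : 'I_n) (A : set R) : \bar R := lebesgue_measure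
  ((fun r : R => r - tnth x j) @^-1` (A `&` [set` `[- s, s]])).
have mIs A : measurable A -> measurable (A `&` [set` `[- s, s]] : set R).
  by move=> mA; apply: measurableI => //; exact: measurable_itv.
have mpre (c : R) (A : set R) : measurable A -> measurable ((fun r : R => r - c) @^-1` A).
  move=> mA; rewrite -[X in measurable X]setTI.
  by apply: measurable_funB => //; exact: measurable_cst.
have mbox A : (forall j, measurable (A j)) -> m (box A) = (\prod_j mi j (A j))%E.
  move=> mA; rewrite mE -tuple_measure_box; last by move=> j; apply: mpre; exact: mIs.
  congr (mu n _); apply/seteqP; split => t.
    by move=> [tA tQ] j; have := tA j; have := tQ j; rewrite /= !tnth_mktuple.
  by move=> tA; split=> j; have [] := tA j; rewrite /= tnth_mktuple.
have mQ2 : m setT = ((2 * s) ^+ n)%:E.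
  have -> : setT = box (fun=> setT) :> set (n.-tuple R) by apply/seteqP; split.
  rewrite mbox// (eq_bigr (fun=> (2 * s)%:E)).
    by rewrite prodEFin prodr_const card_ord.
  move=> j _; rewrite /mi setTI.
  rewrite (_ : _ @^-1` _ = [set` `[tnth x j - s, tnth x j + s]]).
    rewrite lebesgue_measure_itvcc; last by lra.
    by congr (_%:E); ring.
  by apply/seteqP; split => r /=; rewrite !in_itv/= => /andP[? ?]; apply/andP; split; lra.
have mfl e : m (flip e @^-1` Y) = m Y.
  apply: (@flip_box_measure R n m mi) => //; first by rewrite mQ2 ltry.
  (* Before the translation, the reflection at 0 is the reflection at [tnth x j]. *)
  move=> j A mA; rewrite /mi -[RHS](lebesgue_measure_reflect (2 * tnth x j)); last first.
    by apply: mpre; exact: mIs.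
  congr (lebesgue_measure _); apply/seteqP; split => r /=; rewrite !in_itv/=.
    have -> : - (r - tnth x j) = 2 * tnth x j - r - tnth x j by ring.
    by move=> [? /andP[? ?]]; split => //; apply/andP; split; lra.
  have -> : - (r - tnth x j) = 2 * tnth x j - r - tnth x j by ring.
  by move=> [? /andP[? ?]]; split => //; apply/andP; split; lra.
have mQT : m Q = m setT by rewrite !mE setIid preimage_setT setTI.
apply: (@le_trans _ _ (m Y)); last first.
  rewrite mE; apply: le_measure; rewrite ?inE//.
    by apply: measurableI => //; exact: mshV.
  exact: mshV.
rewrite EFinM -mQ2 -mQT; apply: flip_average => //.
move=> y yQ; apply: Yflip => j; have := yQ j.
by rewrite /= in_itv/= ler_norml.
Qed.

End volumes.

(** * Separation and the polar body *)

Lemma continuous_sumr (R : realType) (V : topologicalType) (I : Type) (s : seq I)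
    (h : I -> V -> R) :
  (forall i, continuous (h i)) -> continuous (fun x => \sum_(i <- s) h i x).
Proof.
move=> ch; elim: s => [|i s IH] x.
  under eq_fun do rewrite big_nil; exact: cvg_cst.
under eq_fun do rewrite big_cons; apply: cvgD; [exact: ch|exact: IH].
Qed.

Section absolute_convex_hull.
Context {R : realType} {N n : nat} (G : 'M[R]_(N, n)).

Let dotr i (x : 'I_n -> R) := \sum_j G i j * x j.

Lemma dot_abs_conv_rows (l : 'cV[R]_N) (x : 'I_n -> R) (k : R) :
  (forall i, `|dotr i x| <= k) -> ball1 l -> 0 <= k ->
  \sum_j (G^T *m l) j 0 * x j <= k.
Proof.
move=> xk l1 k0.
rewrite (eq_bigr (fun j => \sum_i G i j * l i 0 * x j)); last first.
  by move=> j _; rewrite !mxE mulr_suml; apply: eq_bigr => i _; rewrite mxE.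
rewrite exchange_big/= (eq_bigr (fun i => l i 0 * dotr i x)); last first.
  by move=> i _; rewrite mulr_sumr; apply: eq_bigr => j _; ring.
apply: (@le_trans _ _ (\sum_i `|l i 0| * k)).
  apply: ler_sum => i _; apply: (le_trans (ler_norm _)); rewrite normrM.
  exact: ler_wpM2l.
by rewrite -mulr_suml -[leRHS]mul1r ler_wpM2r.
Qed.

Lemma ball1_compact : compact [set l : 'rV[R]_N | \sum_i `|l 0 i| <= 1].
Proof.
apply: bounded_closed_compact.
  exists 1; split => // M M1 l /= l1.
  rewrite [leLHS]/Num.norm/= mx_normrE; apply: bigmax_le => [|[i j] _ /=].
    by rewrite (le_trans ler01) ?ltW.
  rewrite ord1; apply: le_trans (ltW M1); apply: le_trans l1.
  by rewrite (bigD1 j)//= lerDl sumr_ge0.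
rewrite (_ : mkset _ = (fun l : 'rV[R]_N => \sum_i `|l 0 i|) @^-1` [set x | x <= 1])//.
apply: closed_comp; last exact: closed_le.
move=> l _; apply: continuous_sumr => i {}l.
by apply: (@continuous_comp _ _ _ (fun l : 'rV[R]_N => l 0 i) Num.norm);
  [exact: coord_continuous|exact: norm_continuous].
Qed.

(** The normal [v] at the point of the hull nearest to [z] separates. The margin [k] on both sides
    is what later allows a rational approximation of [x]. *)
Lemma abs_conv_rows_separation (z : 'cV[R]_n) : ~ abs_conv_rows G z ->
  exists2 k : R, 0 < k & exists x : 'I_n -> R,
    (forall i, `|dotr i x| <= 1 - k) /\ 1 + k <= \sum_j x j * z j 0.
Proof.
move=> Kz.
pose B := [set l : 'rV[R]_N | \sum_i `|l 0 i| <= 1].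
pose res (l : 'rV[R]_N) j := z j 0 - \sum_i l 0 i * G i j.
pose f l := \sum_j res l j ^+ 2.
have B0 : B 0.
  by rewrite /B/= big1// => i _; rewrite mxE normr0.
have cf : {within B, continuous f}.
  apply: continuous_subspaceT; apply: continuous_sumr => j l.
  apply: (@continuous_comp _ _ _ (fun l => res l j) (fun x : R => x ^+ 2));
    last exact: exprn_continuous.
  apply: (@continuousB _ _ _ (fun=> z j 0)
    (fun l : 'rV[R]_N => \sum_i l 0 i * G i j)); first exact: cst_continuous.
  apply: continuous_sumr => i {}l.
  apply: (@continuousM _ _ (fun l : 'rV[R]_N => l 0 i) (fun=> G i j));
    [exact: coord_continuous|exact: cst_continuous].
have [c] := EVT_min_rV (ex_intro _ _ B0) ball1_compact cf.
rewrite inE => Bc cmin.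
pose v := res c.
pose p j := \sum_i c 0 i * G i j.
pose s := \sum_j v j * p j.
pose V := \sum_j v j ^+ 2.
have V0 : 0 < V.
  rewrite lt_def sumr_ge0 ?andbT; last by move=> j _; exact: sqr_ge0.
  apply/negP => /eqP V0; apply: Kz; exists c^T.
    by rewrite /ball1/=; under eq_bigr do rewrite mxE.
  apply/colP => j; rewrite mxE; have /eqP := V0.
  rewrite psumr_eq0 => [/allP/(_ j)|? _]; last exact: sqr_ge0.
  rewrite mem_index_enum => /(_ isT)/=; rewrite sqrf_eq0 subr_eq0 => /eqP ->.
  by apply: eq_bigr => i _; rewrite !mxE mulrC.
(* Variational inequality for the nearest point [p]: otherwise a short step from [c] towards [l]
   would bring the hull point closer to [z]. *)
have vmin (l : 'rV[R]_N) : B l -> \sum_j v j * \sum_i l 0 i * G i j <= s.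
  move=> Bl; rewrite -subr_ge0 /s -sumrB.
  pose w j := \sum_i l 0 i * G i j - p j.
  pose a := \sum_j v j * w j.
  pose W := \sum_j w j ^+ 2.
  have -> : \sum_j (v j * p j - v j * (\sum_i l 0 i * G i j)) = - a.
    by rewrite /a -sumrN; apply: eq_bigr => j _; rewrite /w; ring.
  have W0 : 0 <= W by apply: sumr_ge0 => j _; exact: sqr_ge0.
  rewrite oppr_ge0 leNgt; apply/negP => a0.
  have key t : 0 <= t <= 1 -> 2 * t * a <= t ^+ 2 * W.
    move=> /andP[t0 t1].
    have Bt : B ((1 - t) *: c + t *: l).
      rewrite /B/=; apply: (@le_trans _ _ (\sum_i ((1 - t) * `|c 0 i| + t * `|l 0 i|))).
        apply: ler_sum => i _; rewrite !mxE; apply: (le_trans (ler_normD _ _)).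
        by rewrite !normrM (ger0_norm t0) ger0_norm ?subr_ge0.
      rewrite big_split/= -!mulr_sumr; move: Bc Bl; rewrite /B/= => Bc Bl.
      have t1' : 0 <= 1 - t by lra.
      by have := ler_wpM2l t1' Bc; have := ler_wpM2l t0 Bl; lra.
    have := cmin _ (mem_set Bt).
    have -> : f ((1 - t) *: c + t *: l) = V - 2 * t * a + t ^+ 2 * W.
      rewrite /f /V /a /W !mulr_sumr -sumrB -big_split/=; apply: eq_bigr => j _.
      have -> : res ((1 - t) *: c + t *: l) j = v j - t * w j.
        rewrite /res /v /w /p /res.
        rewrite (eq_bigr (fun i => (1 - t) * (c 0 i * G i j) + t * (l 0 i * G i j))).
          by rewrite big_split/= -!mulr_sumr; ring.
        by move=> i _; rewrite !mxE; ring.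
      by ring.
    by rewrite -/V /f -/V; lra.
  (* The minimum with 1 stays on the segment, and [W + 1] is positive even when [W] vanishes; then
     [t * W <= a < 2 * a] contradicts [key]. *)
  pose t := Num.min 1 (a / (W + 1)).
  have W1 : 0 < W + 1 by lra.
  have t0 : 0 < t by rewrite lt_min ltr01 divr_gt0.
  have t1 : t <= 1 by rewrite ge_min lexx.
  have ta : t * (W + 1) <= a by rewrite -ler_pdivlMr// ge_min lexx orbT.
  have := key t; rewrite (ltW t0) t1 => /(_ isT).
  rewrite expr2 -mulrA mulrCA -[leRHS]mulrA ler_pM2l// => h.
  by move: ta; rewrite mulrDr mulr1; lra.
have s0 : 0 <= s.
  have := vmin 0 B0; rewrite big1// => j _; rewrite big1 ?mulr0// => i _.
  by rewrite mxE mul0r.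
have vrow i : `|dotr i v| <= s.
  have Bd (b : R) : `|b| = 1 -> b * dotr i v <= s.
    move=> b1; have Bb : B (b *: delta_mx 0 i).
      rewrite /B/= (bigD1 i)//= big1 => [|j ji]; rewrite !mxE !eqxx ?(negbTE ji)/=.
        by rewrite mulr1 b1 addr0.
      by rewrite mulr0 normr0.
    apply: le_trans (vmin _ Bb); rewrite /dotr mulr_sumr; apply: ler_sum => j _.
    rewrite (bigD1 i)//= big1 => [|k ki]; rewrite !mxE !eqxx ?(negbTE ki)/=.
      by rewrite addr0 mulr1 le_eqVlt; apply/orP; left; apply/eqP; ring.
    by rewrite mulr0 mul0r.
  rewrite ler_norml; have := Bd 1 (normr1 _); have := Bd (-1).
  by rewrite normrN1 => /(_ erefl) h1 h2; apply/andP; split; lra.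
have vz : \sum_j v j * z j 0 = V + s.
  by rewrite /V /s -big_split/=; apply: eq_bigr => j _; rewrite /v /res -/(p j); ring.
(* Midway between the maximum [s] of [v] over the hull and its value [V + s] at [z], so that
   dividing by [tau] gives the same margin on both sides of 1. *)
pose tau := s + V / 2.
have tau0 : 0 < tau by rewrite /tau; lra.
exists (V / 2 / tau); first by rewrite !divr_gt0.
exists (fun j => v j / tau); split.
  move=> i; have -> : dotr i (fun j => v j / tau) = dotr i v / tau.
    by rewrite /dotr mulr_suml; apply: eq_bigr => j _; rewrite mulrA.
  rewrite normrM normfV (gtr0_norm tau0) ler_pdivrMr// mulrBl mul1r divfK ?gt_eqF//.
  by rewrite /tau addrK.
have -> : \sum_j v j / tau * z j 0 = (V + s) / tau.
  by rewrite -vz mulr_suml; apply: eq_bigr => j _; ring.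
rewrite ler_pdivlMr// mulrDl mul1r divfK ?gt_eqF// /tau; lra.
Qed.

Lemma polar_abs_conv_rows (x : 'cV[R]_n) :
  polar (abs_conv_rows G) x <-> forall i, `|dotr i (fun j => x j 0)| <= 1.
Proof.
split=> [xK i|xG y [l Bl <-]]; last first.
  rewrite (eq_bigr (fun j => (G^T *m l) j 0 * x j 0)); last by move=> j _; rewrite mulrC.
  exact: dot_abs_conv_rows.
have Kd (b : R) : `|b| = 1 -> b * dotr i (fun j => x j 0) <= 1.
  move=> b1; have Bb : ball1 (b *: delta_mx i 0 : 'cV[R]_N).
    rewrite /ball1/= (bigD1 i)//= big1 => [|j ji]; rewrite !mxE !eqxx ?(negbTE ji)/=.
      by rewrite mulr1 b1 addr0.
    by rewrite mulr0 normr0.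
  have := xK _ (ex_intro2 _ _ _ Bb erefl); apply: le_trans.
  rewrite /dotr mulr_sumr; apply: ler_sum => j _.
  have -> : (G^T *m (b *: delta_mx i 0 : 'cV[R]_N)) j 0 = b * G i j.
    rewrite mxE (bigD1 i)//= big1 => [|k ki]; rewrite !mxE !eqxx ?(negbTE ki)/=.
      by rewrite addr0 mulr1 mulrC.
    by rewrite !mulr0.
  by rewrite le_eqVlt; apply/orP; left; apply/eqP; ring.
rewrite ler_norml; have := Kd 1 (normr1 _); have := Kd (-1).
by rewrite normrN1 => /(_ erefl) h1 h2; apply/andP; split; lra.
Qed.

(** The bipolar theorem with rational directions: it exhibits the hull as a countable intersection
    of half-spaces, hence as a measurable set. *)
Lemma abs_conv_rows_rat (z : 'cV[R]_n) : abs_conv_rows G z <->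
  forall q : n.-tuple rat, (forall i, `|dotr i (fun j => ratr (tnth q j))| <= 1) ->
    \sum_j z j 0 * ratr (tnth q j) <= 1.
Proof.
split=> [[l Bl <-] q Gq|zq]; first exact: dot_abs_conv_rows.
apply: contrapT => /abs_conv_rows_separation[k k0 [x [xG xz]]].
(* [C] dominates the l1-norms of [z] and of all rows, so that moving each [x j] by at most
   [k / 2 / C] costs at most half of the margin. *)
pose C := 1 + \sum_i \sum_j `|G i j| + \sum_j `|z j 0|.
have C1 : 1 <= C.
  rewrite /C -addrA lerDl addr_ge0 ?sumr_ge0// => i _; exact: sumr_ge0.
have C0 : 0 < C by lra.
have k2 : 0 < k / 2 / C by rewrite !divr_gt0.
have /choice[q qx] : forall j, exists q : rat, `|ratr q - x j| <= k / 2 / C.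
  move=> j; have xk : x j < x j + k / 2 / C by rewrite ltrDl.
  have [q] := rat_in_itvoo xk.
  rewrite in_itv/= => /andP[q1 q2]; exists q.
  by rewrite ger0_norm; lra.
have near_dot (g : 'I_n -> R) : \sum_j `|g j| <= C ->
    `|\sum_j g j * ratr (q j) - \sum_j g j * x j| <= k / 2.
  move=> gC; rewrite -sumrB; apply: (le_trans (ler_norm_sum _ _ _)).
  apply: (@le_trans _ _ (\sum_j `|g j| * (k / 2 / C))).
    apply: ler_sum => j _; rewrite -mulrBr normrM; exact: ler_wpM2l.
  by rewrite -mulr_suml mulrA ler_pdivrMr// mulrC ler_pM2l// divr_gt0.
have : \sum_j z j 0 * ratr (tnth [tuple q j | j < n] j) <= 1.
  apply: zq => i.
  have -> : dotr i (fun j => ratr (tnth [tuple q j | j < n] j)) =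
      \sum_j G i j * ratr (q j) by apply: eq_bigr => j _; rewrite tnth_mktuple.
  have /near_dot : \sum_j `|G i j| <= C.
    rewrite /C (bigD1 i)//=.
    have h1 : 0 <= \sum_(i0 < N | i0 != i) \sum_j `|G i0 j|.
      by apply: sumr_ge0 => a _; exact: sumr_ge0.
    have h2 : 0 <= \sum_j `|z j 0| by exact: sumr_ge0.
    lra.
  have := xG i; rewrite /dotr => h1 h2.
  rewrite -[X in `|X|](subrK (\sum_j G i j * x j)).
  by apply: (le_trans (ler_normD _ _)); lra.
have -> : \sum_j z j 0 * ratr (tnth [tuple q j | j < n] j) =
   \sum_j z j 0 * ratr (q j) by apply: eq_bigr => j _; rewrite tnth_mktuple.
have /near_dot : \sum_j `|z j 0| <= C.
  have h1 : 0 <= \sum_i \sum_j `|G i j|.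
    by apply: sumr_ge0 => a _; exact: sumr_ge0.
  by rewrite /C; lra.
rewrite ler_norml => /andP[h _] h2.
have zx : \sum_j z j 0 * x j = \sum_j x j * z j 0.
  by apply: eq_bigr => j _; rewrite mulrC.
by rewrite zx in h; lra.
Qed.

Lemma measurable_abs_conv_rows :
  measurable [set t : n.-tuple R | abs_conv_rows G (\col_j tnth t j)].
Proof.
pose F (k : nat) : set (n.-tuple R) :=
  if @unpickle (n.-tuple rat) k is Some q then
    if `[< forall i, `|dotr i (fun j => ratr (tnth q j))| <= 1 >] then
      [set t | \sum_j ratr (tnth q j) * tnth t j <= 1] else setT
  else setT.
rewrite (_ : mkset _ = \bigcap_k F k).
  apply: bigcapT_measurable => k; rewrite /F; case: unpickle => [q|//].
  by case: ifP => // _; apply: measurable_le_set; exact: measurable_dot.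
have qE t (q : n.-tuple rat) : \sum_j (\col_j tnth t j) j 0 * ratr (tnth q j) =
    \sum_j ratr (tnth q j) * tnth t j :> R.
  by apply: eq_bigr => j _; rewrite mxE mulrC.
apply/seteqP; split => t /=.
  move=> /abs_conv_rows_rat Kt k _; rewrite /F; case: unpickle => [q|//].
  by case: asboolP => // /Kt; rewrite qE.
move=> Ft; apply/abs_conv_rows_rat => q Gq.
by have := Ft (pickle q) I; rewrite /F pickleK; case: asboolP => // _; rewrite qE.
Qed.

(** The hull contains the cube of half-side [r^-1]: a point of the cube outside it would be
    separated by some [x] in the polar, of l1-norm at least [r]. *)
Lemma volume_abs_conv_rows_ge (r : R) : 0 < r ->
  (forall x : 'I_n -> R, (forall i, `|dotr i x| <= 1) -> \sum_j `|x j| < r) ->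
  (((2 / r) ^+ n)%:E <= volume (abs_conv_rows G))%E.
Proof.
move=> r0 polr; have rV0 : 0 < r^-1 by rewrite invr_gt0.
have -> : (2 / r) ^+ n = (r^-1 - - r^-1) ^+ n by congr (_ ^+ n); lra.
rewrite -cube_volume; last by lra.
apply: le_measure; rewrite ?inE.
- by apply: measurable_box => j; exact: measurable_itv.
- exact: measurable_abs_conv_rows.
move=> t /= tr; apply: contrapT => /abs_conv_rows_separation[k k0 [x [xG xt]]].
have := polr x; have x1 i : `|dotr i x| <= 1 by apply: (le_trans (xG i)); lra.
move=> /(_ x1); rewrite ltNge => /negP; apply.
suff : 1 <= (\sum_j `|x j|) * r^-1 by rewrite ler_pdivlMr// mul1r.
apply: (@le_trans _ _ (1 + k)); first by lra.
apply: (le_trans xt); rewrite mulr_suml; apply: ler_sum => j _.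
apply: (le_trans (ler_norm _)); rewrite normrM mxE; apply: ler_wpM2l => //.
by have := tr j; rewrite /= in_itv/= ler_norml.
Qed.

Lemma volume_polar_le (r : R) : (0 < n)%N -> 0 < r ->
  (forall x : 'I_n -> R, (forall i, `|dotr i x| <= 1) -> \sum_j `|x j| < r) ->
  (volume (polar (abs_conv_rows G)) <= ((8 * r / n%:R) ^+ n)%:E)%E.
Proof.
move=> n0 r0 polr; apply: le_trans (l1_ball_volume n0 r0).
have dE t i : dotr i (fun j => (\col_j tnth t j) j 0) = \sum_j G i j * tnth t j.
  by apply: eq_bigr => j _; rewrite mxE.
apply: le_measure; rewrite ?inE.
- rewrite (_ : mkset _ = \bigcap_(i in [set: 'I_N])
      [set t | `|\sum_j G i j * tnth t j| <= 1]).
    apply: fin_bigcap_measurable; first exact: finite_finset.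
    move=> i _; apply: measurable_le_set; apply: measurableT_comp => //.
    exact: measurable_dot.
  apply/seteqP; split => t /=.
    by move=> /polar_abs_conv_rows tG i _ /=; rewrite -dE.
  by move=> tG; apply/polar_abs_conv_rows => i; rewrite dE; exact: tG.
- by apply: measurable_le_set; exact: measurable_l1.
move=> t /= /polar_abs_conv_rows tG; apply/ltW/polr => i.
by have := tG i; rewrite dE.
Qed.

End absolute_convex_hull.

(** * The exceptional set *)

Section undetected_set.
Context {R : realType} {N n : nat}.
Implicit Types (g : 'I_N -> n.-tuple R) (t : n.-tuple R).

(** A point of l1-norm [2 * a] stays in this shell after a move of l1-length at most [a]. *)
Definition undetected g (a K k : R) : set (n.-tuple R) :=
  [set t | (a <= \sum_j `|tnth t j| <= 3 * a) /\
     \sum_i \1_(row_event (tnth t) K) (g i) < k].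

(** Rows and point depend on a common parameter, which covers joint measurability for Fubini as well
    as both kinds of sections. *)
Lemma measurable_undetected_pair d (T : measurableType d)
    (g : 'I_N -> T -> n.-tuple R) (th : T -> n.-tuple R) a K k :
  (forall i, measurable_fun setT (g i)) -> measurable_fun setT th ->
  measurable [set w | undetected (fun i => g i w) a K k (th w)].
Proof.
move=> mg mth.
have mt j : measurable_fun setT (fun w => tnth (th w) j).
  exact: (measurableT_comp (measurable_tnth j) mth).
have mgt i j : measurable_fun setT (fun w => tnth (g i w) j).
  exact: (measurableT_comp (measurable_tnth j) (mg i)).
have ml1 : measurable_fun setT (fun w => \sum_j `|tnth (th w) j|).
  by apply: measurable_sum => j; exact: measurableT_comp.
pose B i := [set w | row_event (tnth (th w)) K (g i w)].
have mB i : measurable (B i).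
  apply: measurableI.
    apply: measurable_gt_set; apply: measurableT_comp => //.
    by apply: measurable_sum => j; exact: measurable_funM.
  apply: measurable_le_set; apply: measurable_sum => j; exact: measurable_funX.
rewrite (_ : [set w | _] = ([set w | a <= \sum_j `|tnth (th w) j|] `&`
    [set w | \sum_j `|tnth (th w) j| <= 3 * a]) `&`
    ~` [set w | k <= \sum_i \1_(B i) w]).
  apply: measurableI; first by apply: measurableI;
    [exact: measurable_ge_set|exact: measurable_le_set].
  by apply: measurableC; apply: measurable_ge_set; apply: measurable_sum => i;
    exact: measurable_indic.
have BE w : \sum_i \1_(B i) w = \sum_i \1_(row_event (tnth (th w)) K) (g i w) :> R.
  by apply: eq_bigr => i _; rewrite !indicE.
apply/seteqP; split => w /=; rewrite BE.
  by move=> [/andP[? ?] h]; split=> //; apply/negP; rewrite -ltNge.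
by move=> [[? ?] /negP h]; split; [apply/andP|rewrite ltNge].
Qed.

Lemma measurable_undetected g a K k : measurable (undetected g a K k).
Proof.
by apply: (measurable_undetected_pair (g := fun i _ => g i) (th := id)) => // i;
  exact: measurable_cst.
Qed.

Lemma sum_flip_sqr (x t : n.-tuple R) :
  \sum_(e : n.-tuple bool) (\sum_j tnth x j * tnth (flip e t) j) ^+ 2 =
  2 ^+ n * \sum_j (tnth x j * tnth t j) ^+ 2.
Proof.
under eq_bigr do rewrite dot_flip.
rewrite (sum_sign_mean (fun z => z ^+ 2)).
rewrite (@sign_mean_ext _ _ (fun z => (0 + z) ^+ 2)); last by move=> z; rewrite add0r.
by rewrite sign_mean_sqr expr0n/= add0r big_map big_enum.
Qed.

(** Over the signs, the mean of the sum of squares keeps only diagonal terms and is at most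
    [N * K * s ^+ 2 <= k / 2]; Markov's inequality on the signs, as [1 - F / k] against the
    indicator, gives one half. *)
Lemma half_flips_small g (s K k : R) (y : n.-tuple R) : 0 < k -> 0 <= K ->
  N%:R * (K * s ^+ 2) <= k / 2 -> (forall j, `|tnth y j| <= s) ->
  2^-1 * 2 ^+ n <= \sum_(e : n.-tuple bool)
    \1_[set t | \sum_(i | \sum_j tnth (g i) j ^+ 2 <= K)
      (\sum_j tnth (g i) j * tnth t j) ^+ 2 < k] (flip e y) :> R.
Proof.
move=> k0 K0 NK ys; set Y := [set t | _].
pose F t := \sum_(i | \sum_j tnth (g i) j ^+ 2 <= K)
      (\sum_j tnth (g i) j * tnth t j) ^+ 2.
apply: (@le_trans _ _ (\sum_(e : n.-tuple bool) (1 - F (flip e y) / k))).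
  rewrite sumrB sumr_const card_tuple card_bool natrX -mulr_suml.
  rewrite /F exchange_big/=.
  rewrite (eq_bigr (fun i => 2 ^+ n * \sum_j (tnth (g i) j * tnth y j) ^+ 2)); last first.
    by move=> i _; exact: sum_flip_sqr.
  rewrite -mulr_sumr -mulrA -[X in X - _]mulr1 -mulrBr mulrC ler_pM2l ?exprn_gt0//.
  set Z := \sum_(i | _) _.
  have : Z <= k / 2.
    apply: le_trans NK; apply: (@le_trans _ _ (\sum_(i < N) K * s ^+ 2)).
      rewrite /Z big_mkcond/=; apply: ler_sum => i _; case: ifP => gK; last first.
        by rewrite mulr_ge0 ?sqr_ge0.
      apply: (@le_trans _ _ (\sum_j tnth (g i) j ^+ 2 * s ^+ 2)).
        apply: ler_sum => j _; rewrite exprMn ler_wpM2l ?sqr_ge0//.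
        rewrite -(real_normK (num_real (tnth y j))) ler_sqr ?nnegrE//.
        exact: le_trans (ys j).
      by rewrite -mulr_suml ler_wpM2r ?sqr_ge0.
    by rewrite sumr_const card_ord mulr_natl.
  by move=> Zk; have : Z / k <= 2^-1; [rewrite ler_pdivrMr//; lra|lra].
apply: ler_sum => e _; rewrite indicE.
have F0 : 0 <= F (flip e y) by apply: sumr_ge0 => i _; exact: sqr_ge0.
have [Fk|kF] := ltP (F (flip e y)) k.
  by rewrite mem_set//= gerBl divr_ge0// ltW.
apply: (@le_trans _ _ 0); last exact: ler0n.
by rewrite subr_le0 ler_pdivlMr// mul1r.
Qed.

Lemma polar_in_l1_ball g (a K k s : R) : 0 < a -> 0 <= K -> 0 < k -> 0 <= s ->
  N%:R * (K * s ^+ 2) <= k / 2 -> n%:R * s <= a ->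
  (tuple_measure (@lebesgue_measure R) n (undetected g a K k) <
     (2^-1 * (2 * s) ^+ n)%:E)%E ->
  forall x : 'I_n -> R, (forall i, `|\sum_j tnth (g i) j * x j| <= 1) ->
    \sum_j `|x j| < 2 * a.
Proof.
move=> a0 K0 k0 s0 NK ns mS x xg; rewrite ltNge; apply/negP => ax.
pose l := \sum_j `|x j|; have l0 : 0 < l by rewrite /l; lra.
(* Shrinking to l1-norm exactly [2 * a] keeps all products with the rows at most 1 in absolute
   value. *)
pose c := 2 * a / l.
have c0 : 0 < c by rewrite divr_gt0// mulr_gt0.
have c1 : c <= 1 by rewrite ler_pdivrMr// mul1r.
pose x' := [tuple c * x j | j < n].
have x'l : \sum_j `|tnth x' j| = 2 * a.
  under eq_bigr do rewrite tnth_mktuple normrM (gtr0_norm c0).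
  by rewrite -mulr_sumr -/l /c divfK// gt_eqF.
pose Y0 := [set t | \sum_(i | \sum_j tnth (g i) j ^+ 2 <= K)
      (\sum_j tnth (g i) j * tnth t j) ^+ 2 < k].
pose Y := box (fun _ : 'I_n => [set` `[- s, s]]) `&` Y0.
have mY : measurable Y.
  apply: measurableI; first by apply: measurable_box => j; exact: measurable_itv.
  rewrite (_ : Y0 = ~` [set t | k <= \sum_(i | \sum_j tnth (g i) j ^+ 2 <= K)
      (\sum_j tnth (g i) j * tnth t j) ^+ 2]); last first.
    by apply/seteqP; split => t /=; rewrite /Y0/= ltNge => /negP.
  apply: measurableC; apply: measurable_ge_set.
  under eq_fun do rewrite big_mkcond.
  apply: measurable_sum => i; case: (\sum_j tnth (g i) j ^+ 2 <= K) => //.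
  apply: measurable_funX.
  exact: measurable_dot.
move: mS; rewrite ltNge => /negP; apply.
apply: le_trans (@shifted_half_cube _ _ x' s Y s0 mY _) _.
  move=> y ys; apply: le_trans (half_flips_small g k0 K0 NK ys) _.
  apply: ler_sum => e _; rewrite !indicE ler_nat.
  case: (boolP (flip e y \in Y0)) => //; rewrite inE => h.
  rewrite mem_set//; split => // j; rewrite /= tnth_mktuple in_itv/= -ler_norml.
  by rewrite normrM normrX normrN1 expr1n mul1r.
apply: le_measure; rewrite ?inE.
- have msh : measurable_fun setT
      (fun t : n.-tuple R => [tuple tnth t j - tnth x' j | j < n]).
    apply/measurable_fun_tnthP => j.
    rewrite (_ : _ \o _ = fun t => tnth t j - tnth x' j); last first.
      by apply/funext => t /=; rewrite tnth_mktuple.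
    by apply: measurable_funB => //; exact: measurable_tnth.
  by rewrite -[X in measurable X]setTI; exact: msh.
- exact: measurable_undetected.
move=> t /= [tQ tk].
have ty j : `|tnth t j - tnth x' j| <= s.
  by have := tQ j; rewrite /= tnth_mktuple in_itv/= ler_norml.
split.
  have sn : \sum_j `|tnth t j - tnth x' j| <= a.
    apply: le_trans ns; rewrite -[n in n%:R]card_ord mulr_natl -sumr_const.
    by apply: ler_sum => j _.
  have h1 : \sum_j `|tnth t j| <= \sum_j `|tnth x' j| + \sum_j `|tnth t j - tnth x' j|.
    rewrite -big_split/=; apply: ler_sum => j _.
    by rewrite -{1}(subrK (tnth x' j) (tnth t j)) addrC ler_normD.
  have h2 : \sum_j `|tnth x' j| <= \sum_j `|tnth t j| + \sum_j `|tnth t j - tnth x' j|.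
    rewrite -big_split/=; apply: ler_sum => j _.
    by rewrite -{1}(subKr (tnth t j) (tnth x' j)) ler_normB.
  by apply/andP; split; lra.
apply: le_lt_trans tk; rewrite [leRHS]big_mkcond/=; apply: ler_sum => i _.
rewrite indicE; case: (boolP (_ \in _)) => [|_]; last first.
  by case: ifP => // _; exact: sqr_ge0.
rewrite inE => -[t2 ->]; set z := \sum_j _.
(* A row that detects [x' + y] has product more than 2 with it and at most 1 with [x'], so [y]
   accounts for at least 1. The number of such rows is thus bounded by the sum of squares, which is
   less than [k]. *)
suff z1 : 1 <= `|z| by rewrite -(real_normK (num_real z)) /= expr_ge1.
have xz : \sum_j tnth t j * tnth (g i) j = z + c * \sum_j tnth (g i) j * x j.
  rewrite /z mulr_sumr -big_split/=; apply: eq_bigr => j _.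
  by rewrite !tnth_mktuple; ring.
move: t2; rewrite xz => t2.
have := ler_normD z (c * \sum_j tnth (g i) j * x j).
rewrite normrM (gtr0_norm c0) => h.
have : c * `|\sum_j tnth (g i) j * x j| <= 1 * 1.
  by apply: ler_pM => //; exact: ltW.
lra.
Qed.

End undetected_set.

(** By Fubini the expected volume is at most [p] times that of the l1-ball of radius [3 * a];
    Markov's inequality at level [V] gives the event. *)
Lemma undetected_volume_event d (T : measurableType d) (R : realType)
    (P : probability T R) (N n : nat) (g : 'I_N -> T -> n.-tuple R)
    (a K k p V : R) :
  (0 < n)%N -> 0 < a -> 0 < V -> 0 <= p ->
  (forall i, measurable_fun setT (g i)) ->
  (forall t : n.-tuple R, a <= \sum_j `|tnth t j| ->
    (P [set w | (\sum_i \1_(row_event (tnth t) K) (g i w) < k)%R] <= p%:E)%E) ->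
  exists E : set T, [/\ measurable E,
    ((1 - p * (24 * a / n%:R) ^+ n / V)%:E <= P E)%E &
    forall w, E w -> (tuple_measure (@lebesgue_measure R) n
      (undetected (fun i => g i w) a K k) < V%:E)%E].
Proof.
move=> n0 a0 V0 p0 mg Pt; pose mu := tuple_measure (@lebesgue_measure R) n.
pose D := [set wt : T * n.-tuple R | undetected (fun i => g i wt.1) a K k wt.2].
have mD : measurable D.
  apply: (@measurable_undetected_pair R N n _ (T * n.-tuple R)%type
    (fun i wt => g i wt.1) (fun wt => wt.2)); last exact: measurable_snd.
  by move=> i; apply: (measurableT_comp (mg i)); exact: measurable_fst.
pose F w := mu (xsection D w).
have FE w : F w = mu (undetected (fun i => g i w) a K k).
  by rewrite /F; congr (mu _); apply/seteqP; split => t; rewrite /xsection/= inE.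
have mF : measurable_fun setT F by exact: measurable_fun_xsection.
pose c : R := p * (24 * a / n%:R) ^+ n.
have intF : (\int[P]_w F w <= c%:E)%E.
  have := @indic_fubini_tonelli _ _ _ _ R P mu D mD.
  rewrite indic_fubini_tonelli_FE// indic_fubini_tonelli_GE// -/F => ->.
  pose B := [set t : n.-tuple R | \sum_j `|tnth t j| <= 3 * a].
  have mB : measurable B by apply: measurable_le_set; exact: measurable_l1.
  apply: (@le_trans _ _ (\int[mu]_t (p%:E * (\1_B t)%:E))%E).
    apply: ge0_le_integral => //.
    - exact: measurable_fun_ysection.
    - apply: emeasurable_funM => //; apply/measurable_EFinP; exact: measurable_indic.
    - move=> t _ /=; have [/andP[at_ ta]|tB] := boolP (a <= \sum_j `|tnth t j| <= 3 * a).
        rewrite indicE mem_set//= mule1; apply: le_trans (Pt t at_).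
        apply: le_measure; rewrite ?inE.
        + exact: measurable_ysection.
        + have -> : [set w | \sum_i \1_(row_event (tnth t) K) (g i w) < k] =
              [set w | undetected (fun i => g i w) a K k t].
            by apply/seteqP; split => w /=; [move=> h; split=> //; apply/andP|case].
          exact: (@measurable_undetected_pair R N n _ T g (fun=> t)).
        + by move=> w; rewrite /ysection/= inE => -[].
      rewrite (_ : ysection D t = set0) ?measure0; last first.
        by apply/seteqP; split => w //; rewrite /ysection/= inE => -[h]; rewrite h in tB.
      by rewrite mule_ge0 ?lee_fin.
  rewrite ge0_integralZl_EFin//; last first.
    by apply/measurable_EFinP; exact: measurable_indic.
  rewrite integral_indic// setIT EFinM lee_wpmul2l ?lee_fin//.
  have a3 : 0 < 3 * a by rewrite mulr_gt0.
  have := l1_ball_volume n0 a3.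
  by rewrite (_ : 8 * (3 * a) = 24 * a); last by ring.
have mE : measurable [set w | (V%:E <= F w)%E].
  by rewrite -[X in measurable X]setTI; exact: emeasurable_fun_c_infty.
exists (~` [set w | (V%:E <= F w)%E]); split; first exact: measurableC.
- rewrite probability_setC// EFinB leeD2l// leeN2.
  have F0 w : (0 <= F w)%E by exact: measure_ge0.
  have := le_trans (markov_measure P mF F0 (ltW V0)) intF.
  rewrite -/c => h.
  by rewrite EFinM lee_pdivlMr// muleC.
- by move=> w /= /negP; rewrite -ltNge FE.
Qed.

Section polar_event.
Context d (T : measurableType d) (R : realType) (P : probability T R).
Context (N n : nat) (xi : 'I_N -> 'I_n -> {RV P >-> R}) (u v : R).

Lemma polar_event (m b : nat) : 0 < u < 1 -> 0 < v < 1 ->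
  (0 < n)%N -> (0 < N)%N -> (0 < b)%N -> (n <= m * b)%N -> (b <= 2 * n)%N ->
  mutually_independent (fun ij : 'I_N * 'I_n => xi ij.1 ij.2) ->
  (forall i j, symmetric_RV P (xi i j)) ->
  (forall i j, 'V_P[xi i j] = 1%E) ->
  (forall i j, (concentration P (xi i j) u <= v%:E)%E) ->
  exists E : set T, [/\ measurable E,
    ((1 - 2 * (72 ^+ 2 / (u * (1 - v) ^+ 2) * 10 ^+ m) ^+ n *
        expR (- ((1 - v) / 16 * 10^-1 ^+ m * N%:R)))%:E <= P E)%E &
    forall w, E w -> forall x : 'I_n -> R,
      (forall i, `|\sum_j random_matrix xi w i j * x j| <= 1) ->
      \sum_j `|x j| < 2 * (9 * Num.sqrt b%:R / (u * (1 - v)))].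
Proof.
move=> u01 v01 n0 N0 b0 nmb b2n xi_ind xi_sym xi_var xi_conc.
have /andP[u0 u1] := u01; have /andP[v0 v1] := v01.
have v1' : 0 < 1 - v by lra.
have nR : 0 < n%:R :> R by rewrite ltr0n.
have NR : 0 < N%:R :> R by rewrite ltr0n.
have bR : 0 < b%:R :> R by rewrite ltr0n.
pose q : R := 10^-1 ^+ m.
have q0 : 0 < q by rewrite exprn_gt0// invr_gt0.
pose sb : R := Num.sqrt b%:R.
have sb0 : 0 < sb by rewrite sqrtr_gt0.
have sb2 : sb ^+ 2 = b%:R by rewrite sqr_sqrtr// ltW.
pose sq : R := Num.sqrt (q / n%:R).
have sq0 : 0 < sq by rewrite sqrtr_gt0 divr_gt0.
have sq2 : sq ^+ 2 = q / n%:R by rewrite sqr_sqrtr// ltW// divr_gt0.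
have qm : q * 10 ^+ m = 1 by rewrite /q exprVn mulVf ?gt_eqF ?exprn_gt0.
(* From [n <= m * b] and [m <= 10 ^+ m]. *)
have nqb : n%:R * q <= b%:R.
  have h1 : n%:R <= m%:R * b%:R :> R by rewrite -natrM ler_nat.
  have h2 : m%:R <= 10 ^+ m :> R by rewrite -natrX ler_nat ltnW// ltn_expl.
  have h3 := ler_wpM2r (ltW q0) h1.
  have h4 := ler_wpM2r (ltW bR) (ler_wpM2r (ltW q0) h2).
  rewrite [10 ^+ m * q]mulrC qm mul1r in h4.
  by apply: (le_trans h3); rewrite mulrAC.
have sq_le_sb : n%:R * sq <= sb.
  rewrite -ler_sqr ?nnegrE ?mulr_ge0 ?(ltW sq0) ?(ltW sb0)// exprMn sq2 sb2.
  have -> : n%:R ^+ 2 * (q / n%:R) = n%:R * q; last exact: nqb.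
  by rewrite expr2 -mulrA (mulrCA n%:R q) mulfV ?mulr1 ?gt_eqF.
(* Compares the scale of the shell with that of the cube, and is the source of the factor [10 ^+ m]
   in the failure probability; the square 9/4 of 3/2 absorbs [b <= 2 * n]. *)
have sb_le_sq : sb <= 3 / 2 * 10 ^+ m * n%:R * sq.
  have t0 : (0 : R) < 10 ^+ m by rewrite exprn_gt0.
  have t1 : (1 : R) <= 10 ^+ m by rewrite exprn_ege1// ler1n.
  rewrite -ler_sqr ?nnegrE ?mulr_ge0 ?divr_ge0// ?(ltW sb0)// ?(ltW sq0) ?(ltW t0)//.
  rewrite exprMn sq2 sb2.
  have -> : (3 / 2 * 10 ^+ m * n%:R) ^+ 2 * (q / n%:R) =
      9 / 4 * (q * 10 ^+ m) * (10 ^+ m * n%:R).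
    have F (x y z : R) : x != 0 ->
        (3 / 2 * z * x) ^+ 2 * (y / x) = 9 / 4 * (y * z) * (z * x) by move=> ?; field.
    by apply: F; rewrite gt_eqF.
  rewrite qm mulr1; have : b%:R <= 2 * n%:R :> R by rewrite -natrM ler_nat.
  have := ler_wpM2r (ltW nR) t1; lra.
pose a := 9 * sb / (u * (1 - v)).
have a0 : 0 < a by rewrite !divr_gt0 ?mulr_gt0.
pose K := 16 / (1 - v) * n%:R.
pose p0 := (1 - v) / 4 * q.
have p00 : 0 < p0 by rewrite mulr_gt0// divr_gt0.
(* Half of the Chernoff exponent [p0 * N / 2], so that the bound [expR (k - p0 * N / 2)] becomes
   [expR (- k)]. *)
pose k := p0 * N%:R / 4.
have k0 : 0 < k by rewrite divr_gt0 ?mulr_gt0.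
(* With this half-side [N * K * s ^+ 2] equals [k / 4] and [n * s] stays below [a]. *)
pose s := (1 - v) / 32 * sq.
have s0 : 0 < s by rewrite mulr_gt0// divr_gt0.
pose V := 2^-1 * (2 * s) ^+ n.
have V0 : 0 < V by rewrite mulr_gt0 ?exprn_gt0 ?mulr_gt0// invr_gt0.
pose g i w := row_tuple (xi i) w.
have mg i : measurable_fun setT (g i) by exact: measurable_row_tuple.
have count (t : n.-tuple R) : a <= \sum_j `|tnth t j| ->
    (P [set w | (\sum_i \1_(row_event (tnth t) K) (g i w) < k)%R] <=
      (expR (- k))%:E)%E.
  move=> at_; have -> : - k = k - p0 * N%:R / 2 by rewrite /k; lra.
  apply: (@row_count_chernoff _ _ _ P N n xi xi_ind (fun=> row_event (tnth t) K)).
  - by move=> i; exact: measurable_row_event.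
  - exact: ltW.
  - move=> i; apply: (row_event_prob (u := u) (b := b)) => //.
    by move=> A mA; exact: row_box.
have [E [mE PE EV]] := undetected_volume_event n0 a0 V0 (expR_ge0 (- k)) mg count.
exists E; split => //.
  apply: le_trans PE; rewrite lee_fin lerD2l lerN2.
  have -> : (1 - v) / 16 * 10^-1 ^+ m * N%:R = k by rewrite /k /p0 -/q; field.
  have -> : expR (- k) * (24 * a / n%:R) ^+ n / V =
      2 * (24 * a / n%:R / (2 * s)) ^+ n * expR (- k).
    rewrite [in RHS]expr_div_n /V invfM invrK; move: (_ ^+ n) ((2 * s) ^+ n) => y z; ring.
  rewrite ler_pM2r ?expR_gt0// ler_pM2l//; apply: lerXn2r; rewrite ?nnegrE.
  - by apply: ltW; rewrite !(divr_gt0, mulr_gt0).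
  - by apply: ltW; rewrite !(divr_gt0, mulr_gt0, exprn_gt0).
  rewrite ler_pdivrMr ?mulr_gt0//.
  have -> : 72 ^+ 2 / (u * (1 - v) ^+ 2) * 10 ^+ m * (2 * s) =
      216 / (u * (1 - v)) / n%:R * (3 / 2 * 10 ^+ m * n%:R * sq).
    by rewrite /s; field; rewrite !gt_eqF.
  have -> : 24 * a / n%:R = 216 / (u * (1 - v)) / n%:R * sb.
    by rewrite /a; field; rewrite !gt_eqF.
  by apply: ler_wpM2l => //; apply: ltW; rewrite !(divr_gt0, mulr_gt0).
move=> w Ew x xG; apply: (@polar_in_l1_ball R N n (fun i => g i w) a K k s) => //.
- by rewrite mulr_ge0 ?divr_ge0 ?ltW.
- exact: ltW.
- have -> : N%:R * (K * s ^+ 2) = k / 4.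
    by rewrite /K /s exprMn sq2 /k /p0; field; rewrite !gt_eqF.
  by lra.
- apply: (@le_trans _ _ sb).
    rewrite /s mulrCA; apply: le_trans sq_le_sb; rewrite ler_piMl ?mulr_ge0 ?(ltW sq0)//.
    by lra.
  rewrite /a ler_pdivlMr ?mulr_gt0// mulrC ler_pM2r//.
  by have : u * (1 - v) <= 1 * 1; [apply: ler_pM; lra|lra].
- exact: EV.
- move=> i; have := xG i; congr (`|_| <= _); apply: eq_bigr => j _.
  by rewrite mxE tnth_mktuple.
Qed.

End polar_event.

(** * Choice of the constants *)

Section constants.
Context {R : realType}.

Lemma ten_le_expR4 : 10 <= expR 4 :> R.
Proof.
have e2 : 2 <= expR 1 :> R by apply: le_trans (expR_ge1Dx _); lra.
rewrite -[4](mulr_natr 1 4) expRM_natr.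
apply: (@le_trans _ _ (2 ^+ 4)); first by rewrite -natrX ler_nat.
by rewrite lerXn2r ?nnegrE// expR_ge0.
Qed.

Lemma expR_ge_half_sqr (x : R) : 0 <= x -> x ^+ 2 / 2 <= expR x.
Proof.
by move=> x0; apply: le_trans (expR_ge1Dxn 1 x0); rewrite lerDr.
Qed.

(* The left-hand side is the failure probability in [polar_event] for N = n e ^ L;
   the point is that 10 ^ m <= e ^ (beta L / 2). *)
Lemma failure_probability_le (beta v D L : R) (n m : nat) :
  0 < beta < 1 -> 0 < v < 1 -> 0 < D -> (0 < n)%N ->
  m%:R <= beta * L / 8 ->
  64 / (beta * (1 - v)) <= L -> 256 / (1 - v) <= L -> 2 * (1 + D) <= L ->
  2 * (D * 10 ^+ m) ^+ n *
    expR (- ((1 - v) / 16 * 10^-1 ^+ m * (n%:R * expR L))) <=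
  expR (- (n%:R * expR (L * (1 - beta)))).
Proof.
move=> /andP[b0 b1] /andP[v0 v1] D0 n0 mL L1 L2 L3.
have v1' : 0 < 1 - v by lra.
have nR : 1 <= n%:R :> R by rewrite ler1n.
have nR0 : 0 < n%:R :> R by lra.
have L0 : 0 < L by lra.
(* The 8 in [m <= beta * L / 8] comes from here: [10 ^+ m <= expR (4 * m)]. *)
have tm : 10 ^+ m <= expR (beta * L / 2) :> R.
  apply: (@le_trans _ _ (expR (4 * m%:R))).
    rewrite expRM_natr; apply: lerXn2r; rewrite ?nnegrE ?expR_ge0//.
    exact: ten_le_expR4.
  by rewrite ler_expR; lra.
have tmV : expR (- (beta * L / 2)) <= 10^-1 ^+ m :> R.
  by rewrite expRN exprVn lef_pV2 ?posrE ?expR_gt0 ?exprn_gt0.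
have De : D <= expR D by have := expR_ge1Dx D; lra.
have e2 : 2 <= expR n%:R :> R by apply: le_trans (expR_ge1Dx _); lra.
apply: (@le_trans _ _ (expR n%:R * (expR D * expR (beta * L / 2)) ^+ n *
    expR (- ((1 - v) / 16 * expR (- (beta * L / 2)) * (n%:R * expR L))))).
  apply: ler_pM; rewrite ?expR_ge0//.
  - by rewrite mulr_ge0// exprn_ge0// mulr_ge0 ?exprn_ge0// ltW.
  - apply: ler_pM => //; first by rewrite exprn_ge0// mulr_ge0 ?exprn_ge0// ltW.
    apply: lerXn2r; rewrite ?nnegrE ?mulr_ge0 ?expR_ge0 ?exprn_ge0 ?(ltW D0)//.
    by apply: ler_pM; rewrite ?exprn_ge0// ltW.
  - rewrite ler_expR lerN2 ler_pM2r ?mulr_gt0 ?expR_gt0// ler_pM2l//.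
    by rewrite divr_gt0.
rewrite -expRD -expRM_natr -!expRD ler_expR.
have -> : (1 - v) / 16 * expR (- (beta * L / 2)) * (n%:R * expR L) =
    n%:R * (2 * ((1 - v) / 32 * expR (L * (1 - beta / 2)))).
  have -> : L * (1 - beta / 2) = - (beta * L / 2) + L by ring.
  by rewrite expRD; field.
set Y := expR (L * (1 - beta / 2)); set Z := expR (L * (1 - beta)).
(* Half of the exponent pays for the target: [expR (beta * L / 2)] exceeds [32 / (1 - v)] by the
   first lower bound on [L]. *)
have h1 : Z <= (1 - v) / 32 * Y.
  have YE : Y = Z * expR (beta * L / 2) by rewrite /Y /Z -expRD; congr expR; field.
  rewrite YE mulrCA ler_peMr ?expR_ge0//.
  have := expR_ge1Dx (beta * L / 2); move: L1.
  rewrite ler_pdivrMr ?mulr_gt0// => L1 h.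
  have h' := ler_wpM2l (ltW v1') h.
  by move: L1 h'; rewrite !mulrDr; lra.
(* The other half pays for the volume ratio: the left side is at most [L], while [Y] is at least
   [L ^+ 2 / 8]. *)
have h2 : 1 + D + beta * L / 2 <= (1 - v) / 32 * Y.
  have : (L / 2) ^+ 2 / 2 <= Y.
    apply: le_trans (expR_ge_half_sqr _) _; first by lra.
    by rewrite /Y ler_expR; nra.
  move=> /(ler_wpM2l (ltW v1')) h.
  move: L2; rewrite ler_pdivrMr// => L2.
  have := ler_wpM2r (ltW L0) L2 => h3.
  have : beta * L <= L by rewrite ler_piMl// ltW.
  by move: h h3; rewrite expr_div_n; lra.
have h3 : n%:R * (Z + (1 + D + beta * L / 2)) <= n%:R * (2 * ((1 - v) / 32 * Y)).
  by rewrite ler_pM2l//; lra.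
by move: h3; rewrite mulrDr; lra.
Qed.

End constants.

Theorem theorem4p10 (R : realType) :
  exists C c : R, [/\ 0 < C, 0 < c &
  forall u v beta : R, 0 < u < 1 -> 0 < v < 1 -> 0 < beta < 1 ->
  exists M Cuvb : R, [/\ 0 < M, 0 < Cuvb &
  forall n N : nat, (0 < n)%N -> (0 < N)%N ->
    M * n%:R < N%:R -> N%:R <= expR n%:R :> R ->
  forall (d : measure_display) (T : measurableType d) (P : probability T R)
         (xi : 'I_N -> 'I_n -> {RV P >-> R}),
    mutually_independent (fun ij : 'I_N * 'I_n => xi ij.1 ij.2) ->
    (forall i j, symmetric_RV P (xi i j)) ->
    (forall i j, 'V_P[xi i j] = 1%E) ->
    (forall i j k, identically_distributed P (xi i j) (xi i k)) ->
    (forall i j, (concentration P (xi i j) u <= v%:E)%E) ->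
  let K w := abs_conv_rows (random_matrix xi w) in
  exists E : set T,
    [/\ measurable E,
        ((1 - expR (- (c * n%:R `^ beta * N%:R `^ (1 - beta))))%:E <= P E)%E &
        forall w, E w ->
          ((2 * Cuvb * Num.sqrt (ln (N%:R / n%:R) / n%:R))%:E
             <= volume (K w) `^ n%:R^-1)%E /\
          (volume (polar (K w)) `^ n%:R^-1
             <= (C / (Cuvb * Num.sqrt (n%:R * ln (N%:R / n%:R))))%:E)%E]]].
Proof.
(* The 8 is the constant of [l1_ball_volume]. *)
exists 8, 1; split => // u v beta u01 v01 beta01.
have /andP[u0 u1] := u01; have /andP[v0 v1] := v01; have /andP[be0 be1] := beta01.
have v1' : 0 < 1 - v by lra.
pose D := 72 ^+ 2 / (u * (1 - v) ^+ 2).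
have D0 : 0 < D by rewrite /D !(divr_gt0, mulr_gt0, exprn_gt0).
(* The first three terms are the demands of [failure_probability_le]; the last makes the number [m]
   of blocks positive. *)
pose L0 := 64 / (beta * (1 - v)) + 256 / (1 - v) + 2 * (1 + D) + 8 / beta.
have l1 : 0 < 64 / (beta * (1 - v)) by rewrite !(divr_gt0, mulr_gt0).
have l2 : 0 < 256 / (1 - v) by rewrite divr_gt0.
have l3 : 0 < 8 / beta by rewrite divr_gt0.
pose sF : R := Num.sqrt (32 / beta).
have sF0 : 0 < sF by rewrite sqrtr_gt0 divr_gt0.
pose F := 9 * sF / (u * (1 - v)).
have F0 : 0 < F by rewrite /F !(divr_gt0, mulr_gt0).
(* [M = expR L0] means [L0 < ln (N / n)]. The polar will lie in the l1-ball of radius [2 * a] with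
   [a <= F * sqrt (n / L)], whence the second constant. *)
exists (expR L0), (2 * F)^-1; split; [exact: expR_gt0|by rewrite invr_gt0 mulr_gt0|].
move=> n N n0 N0 MN Ne d T P xi xi_ind xi_sym xi_var _ xi_conc K.
have nR : 0 < n%:R :> R by rewrite ltr0n.
have NR : 0 < N%:R :> R by rewrite ltr0n.
have n1 : 1 <= n%:R :> R by rewrite ler1n.
pose L : R := ln (N%:R / n%:R).
have eL : expR L = N%:R / n%:R by rewrite /L lnK// posrE divr_gt0.
have NE : N%:R = n%:R * expR L by rewrite eL mulrCA divff ?mulr1// gt_eqF.
have LL0 : L0 < L by rewrite -ltr_expR eL ltr_pdivlMr.
have LL : 64 / (beta * (1 - v)) <= L /\ 256 / (1 - v) <= L /\ 2 * (1 + D) <= L /\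
   8 / beta <= L by rewrite /L0 in LL0; lra.
case: LL => La [Lb [Lc Ld]].
have Lgt0 : 0 < L by lra.
(* This turns the bound [N <= expR n] into [m <= n], so that [b * m <= 2 * n] below. *)
have Ln : L <= n%:R.
  rewrite -ler_expR eL; apply: le_trans Ne.
  by rewrite ler_pdivrMr// ler_peMr// ltW.
pose m := Num.truncn (beta * L / 8).
have bL0 : 0 <= beta * L / 8 by rewrite divr_ge0 ?mulr_ge0// ltW.
have /andP[m1] := truncn_itv bL0; rewrite -/m -[m.+1%:R]natr1 => m2.
rewrite -/m in m1.
have bL1 : 1 <= beta * L / 8.
  by move: Ld; rewrite ler_pdivrMr//; lra.
have m0 : (0 < m)%N by rewrite -(ltr0n R); lra.
have mR : 1 <= m%:R :> R by rewrite ler1n.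
have mn : (m <= n)%N.
  rewrite -(ler_nat R); apply: (le_trans m1); apply: le_trans Ln.
  have : beta * L <= L by rewrite ler_piMl// ltW.
  by lra.
(* The successor makes [m] blocks of length [b] cover all [n] coordinates. *)
pose b := (n %/ m).+1.
have nmb : (n <= m * b)%N by rewrite mulnC ltnW// -ltn_divLR.
have bm : (b * m <= 2 * n)%N.
  by rewrite /b mulSn mul2n -addnn leq_add// leq_trunc_div.
have b2n : (b <= 2 * n)%N by apply: leq_trans bm; rewrite leq_pmulr.
have [E [mE PE EK]] := polar_event u01 v01 n0 N0 (ltn0Sn _) nmb b2n xi_ind
  xi_sym xi_var xi_conc.
exists E; split=> //.
  apply: le_trans PE; rewrite lee_fin lerD2l lerN2.
  have -> : 1 * n%:R `^ beta * N%:R `^ (1 - beta) = n%:R * expR (L * (1 - beta)).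
    rewrite mul1r NE powRM ?expR_ge0// mulrA -powRD; last first.
      by apply/implyP => _; rewrite gt_eqF.
    by rewrite addrC subrK powRr1// -expRM.
  have := failure_probability_le beta01 v01 D0 n0 m1 La Lb Lc.
  by rewrite -NE.
move=> w Ew; have polw := EK w Ew.
pose a : R := 9 * Num.sqrt b%:R / (u * (1 - v)); rewrite -/a in polw.
have a0 : 0 < a by rewrite /a !(divr_gt0, mulr_gt0)// sqrtr_gt0 ltr0n.
have a20 : 0 < 2 * a by rewrite mulr_gt0.
pose r : R := Num.sqrt (n%:R / L).
have r0 : 0 < r by rewrite sqrtr_gt0 divr_gt0.
(* As [1 <= m] and [beta * L / 8 < m + 1], also [beta * L / 16 <= m]; with [b * m <= 2 * n] this
   gives [b <= 32 * n / (beta * L)], hence the 32 in [sF]. *)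
have aF : a <= F * r.
  rewrite /a /F [9 * sF / _ * r]mulrAC ler_pM2r ?invr_gt0 ?mulr_gt0//.
  rewrite -mulrA ler_pM2l// /sF /r -sqrtrM; last by rewrite divr_ge0// ltW.
  apply: ler_wsqrtr.
  have bmR : b%:R * m%:R <= 2 * n%:R :> R by rewrite -!natrM ler_nat.
  have h : b%:R * (beta * L / 16) <= 2 * n%:R.
    apply: le_trans bmR; rewrite ler_pM2l ?ltr0n//.
    by lra.
  have -> : 32 / beta * (n%:R / L) = 32 * n%:R / (beta * L).
    by field; rewrite !gt_eqF.
  by rewrite ler_pdivlMr ?mulr_gt0//; lra.
have nV : 0 <= n%:R^-1 :> R by rewrite invr_ge0.
have poweRn (z : R) : 0 <= z -> ((z ^+ n)%:E `^ n%:R^-1)%E = z%:E.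
  move=> z0; rewrite poweR_EFin -powR_mulrn// -powRrM divff ?powRr1//.
  by rewrite gt_eqF.
have in0y (z : \bar R) : (0 <= z)%E -> z \in `[0%E, +oo%E].
  by move=> z0; rewrite in_itv/= z0 leey.
have sLn : Num.sqrt (L / n%:R) = r^-1.
  by rewrite /r -sqrtrV ?divr_ge0 ?(ltW Lgt0)// invf_div.
split.
- have := volume_abs_conv_rows_ge a20 polw.
  move=> /(gt0_ler_poweR nV (in0y _ _) (in0y _ _)) h.
  have v0' : (0 <= volume (K w))%E by exact: measure_ge0.
  have x0 : (0 <= ((2 / (2 * a)) ^+ n)%:E)%E.
    by rewrite lee_fin exprn_ge0// divr_ge0// ltW.
  apply: le_trans (h x0 v0'); rewrite poweRn ?divr_ge0 ?(ltW a20)// lee_fin.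
  rewrite -/L sLn.
  have -> : 2 / (2 * a) = a^-1 by field; rewrite gt_eqF.
  have -> : 2 * (2 * F)^-1 * r^-1 = (F * r)^-1 by field; rewrite !gt_eqF.
  by rewrite lef_pV2 ?posrE// mulr_gt0.
- have := volume_polar_le n0 a20 polw.
  move=> /(gt0_ler_poweR nV (in0y _ _) (in0y _ _)) h.
  have v0' : (0 <= volume (polar (K w)))%E by exact: measure_ge0.
  have y0 : 0 <= 8 * (2 * a) / n%:R by rewrite divr_ge0// mulr_ge0// ltW.
  have x0 : (0 <= ((8 * (2 * a) / n%:R) ^+ n)%:E)%E by rewrite lee_fin exprn_ge0.
  apply: le_trans (h v0' x0) _; rewrite poweRn// lee_fin -/L.
  have -> : Num.sqrt (n%:R * L) = n%:R / r.
    have -> : n%:R * L = n%:R ^+ 2 * (L / n%:R) by field; rewrite gt_eqF.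
    by rewrite sqrtrM ?sqr_ge0// sqrtr_sqr ger0_norm// sLn.
  have -> : 8 / ((2 * F)^-1 * (n%:R / r)) = 8 * (2 * (F * r)) / n%:R.
    by field; rewrite !gt_eqF.
  by rewrite ler_pM2r ?invr_gt0// ler_pM2l// ler_pM2l.
Qed.
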